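(* Let $D\subseteq[n-1]$ and let $\alpha\in\mathsf{Comp}_n(D)$ be a weak composition that avoids each of the composition patterns $(0,1,2)$, $(0,0,2,2)$, $(0,0,2,1)$, $(1,0,3,2)$, $(1,0,2,2)$. Then $\kappa_\alpha$ is $D$-multiplicity-free if either: (I) $\alpha$ has all parts distinct, that is, $\alpha_i\ne\alpha_j$ for $i\neq j$; or (II) $\alpha$ also avoids $(0,0,1,1)$.
   Context: A weak composition of length $n$ is $\alpha=(\alpha_1,\ldots,\alpha_n)\in\mathbb{Z}_{\ge0}^n$; a descent of $\alpha$ is an index $j$ with $\alpha_j>\alpha_{j+1}$; $\mathsf{Comp}_n(D)$ is the set of weak compositions of length $n$ all of whose descents lie in $D$. Composition patterns: $\alpha=(\alpha_1,\ldots,\alpha_\ell)$ contains $\beta=(\beta_1,\ldots,\beta_k)$ if there are $j_1<\cdots<j_k$ such that for all $s,t$: $\alpha_{j_s}\le\alpha_{j_t}$ if and only if $\beta_s\le\beta_t$, and $|\alpha_{j_s}-\alpha_{j_t}|\ge|\beta_s-\beta_t|$. Otherwise $\alpha$ avoids $\beta$. Key polynomials: for $f\in\mathbb{Z}[x_1,\ldots,x_n]$ let $s_jf$ be $f$ with $x_j,x_{j+1}$ exchanged, and $\pi_j(f)=\frac{x_jf-x_{j+1}s_jf}{x_j-x_{j+1}}$. For $\alpha\in\mathbb{Z}_{\ge0}^n$, $\kappa_\alpha=x^\alpha$ if $\alpha$ is weakly decreasing; otherwise $\kappa_\alpha=\pi_j(\kappa_{\hat\alpha})$ for any $j$ with $\alpha_{j+1}>\alpha_j$,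 where $\hat\alpha$ is $\alpha$ with entries $j,j+1$ exchanged (this is well defined). Split symmetry: write $D=\{d_1<\cdots<d_k\}$, $d_0=0$, $d_{k+1}=n$. $\Pi_D$ is the ring of polynomials in $x_1,\ldots,x_n$ that are separately symmetric in each $X_i=\{x_{d_{i-1}+1},\ldots,x_{d_i}\}$, $1\le i\le k+1$. For $\alpha\in\mathsf{Comp}_n(D)$ one has $\kappa_\alpha\in\Pi_D$. The $D$-Schur polynomials $s_{\lambda^1}(X_1)\cdots s_{\lambda^{k+1}}(X_{k+1})$, where $\lambda^i$ is a partition with $d_i-d_{i-1}$ (possibly zero) parts and $s_\mu$ is the usual Schur polynomial, form a $\mathbb{Z}$-basis of $\Pi_D$. An $f\in\Pi_D$ is $D$-multiplicity-free if all coefficients of its expansion in $D$-Schur polynomials lie in $\{0,1\}$. *)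

(* Defs.v *)
From HB Require Import structures.
From mathcomp Require Import all_boot all_order all_fingroup all_algebra.
From mathcomp Require Import finmap.
From mathcomp Require Export mpoly.
From mathcomp Require Import ring zify.
From Stdlib Require Import ClassicalEpsilon.

Set Implicit Arguments.
Unset Strict Implicit.
Unset Printing Implicit Defensive.

Import GRing.Theory.
Local Open Scope ring_scope.

(* Positions and variables are 0-based: entry alpha_j (resp. variable x_j) of
   the mathematics, 1 <= j <= n, sits at the ordinal j - 1 : 'I_n. *)

(* A descent alpha_d > alpha_{d+1}, 1 <= d <= n - 1, compares the ordinals d - 1
   and d; accordingly D, a subset of [n-1], is given as a set of ordinals, every
   member d : 'I_n of which is positive. *)
Definition in_Comp (n : nat) (D : {set 'I_n}) (alpha : n.-tuple nat) : Prop :=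
  forall d : 'I_n, (0 < d)%N ->
    (nth 0%N alpha d < nth 0%N alpha d.-1)%N -> d \in D.

Definition contains_pattern (a b : seq nat) : Prop :=
  exists2 f : 'I_(size b) -> 'I_(size a),
    {homo f : s t / (s < t)%N} &
    forall s t : 'I_(size b),
      (nth 0%N a (f s) <= nth 0%N a (f t))%N = (nth 0%N b s <= nth 0%N b t)%N /\
      (`|(nth 0%N b s)%:Z - (nth 0%N b t)%:Z| <=
         `|(nth 0%N a (f s))%:Z - (nth 0%N a (f t))%:Z|)%R.

Definition avoids (a b : seq nat) : Prop := ~ contains_pattern a b.

Definition swap_entries (n : nat) (i j : 'I_n) (alpha : n.-tuple nat) :
    n.-tuple nat :=
  [tuple tnth alpha (tperm i j x) | x < n].

(* The quotient (x_i f - x_j s f) / (x_i - x_j), where s exchanges x_i and x_j;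
   for i != j it exists by [demazureP] and is unique by [demazure_unique]. *)
Definition demazure (n : nat) (i j : 'I_n) (f : {mpoly int[n]}) :
    {mpoly int[n]} :=
  epsilon (inhabits 0) (fun g =>
    ('X_i - 'X_j) * g = 'X_i * f - 'X_j * msym (tperm i j) f).

Inductive is_key (n : nat) : n.-tuple nat -> {mpoly int[n]} -> Prop :=
| is_key_dominant (alpha : n.-tuple nat) :
    sorted geq alpha -> is_key alpha 'X_[Multinom alpha]
| is_key_ascent (alpha : n.-tuple nat) (i j : 'I_n) (f : {mpoly int[n]}) :
    j = i.+1 :> nat -> (tnth alpha i < tnth alpha j)%N ->
    is_key (swap_entries i j alpha) f -> is_key alpha (demazure i j f).

(* By [is_key_exists] and [is_key_unique] below, [key alpha] is the only
   polynomial related to alpha, whatever the ascents chosen. *)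
Definition key (n : nat) (alpha : n.-tuple nat) : {mpoly int[n]} :=
  epsilon (inhabits 0) (is_key alpha).

Definition cuts (n : nat) (D : {set 'I_n}) : seq nat :=
  0%N :: rcons [seq val d | d <- enum D] n.

(* X_{i+1} = {x_{d_i + 1}, ..., x_{d_{i+1}}}, for 0 <= i <= k = #|D| *)
Definition block (n : nat) (D : {set 'I_n}) (i : 'I_#|D|.+1) : {set 'I_n} :=
  [set x : 'I_n | (nth 0 (cuts D) i <= x)%N && (x < nth 0 (cuts D) i.+1)%N].

Definition split_symmetric (n : nat) (D : {set 'I_n}) (f : {mpoly int[n]}) :
    Prop :=
  forall (i : 'I_#|D|.+1) (s : {perm 'I_n}),
    perm_on (block i) s -> msym s f = f.

Definition cell (mu : seq nat) : finType :=
  {r : 'I_(size mu) & 'I_(nth 0%N mu r)}.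

Definition semistandard (n : nat) (mu : seq nat)
    (T : {ffun cell mu -> 'I_n}) : bool :=
  [forall c : cell mu, forall c' : cell mu,
    ((tag c == tag c') && (tagged c < tagged c')%N ==> (T c <= T c')%N) &&
    ((tag c < tag c')%N && (tagged c == tagged c' :> nat) ==> (T c < T c')%N)].

(* s_mu in the variables x_b, b \in B *)
Definition schur (n : nat) (B : {set 'I_n}) (mu : seq nat) : {mpoly int[n]} :=
  \sum_(T : {ffun cell mu -> 'I_n} |
        semistandard T && [forall c, T c \in B]) \prod_(c : cell mu) 'X_(T c).

(* A partition with m parts is a weakly decreasing list of length m, trailing
   zeros included. *)
Definition is_D_partition (n : nat) (D : {set 'I_n})
    (la : #|D|.+1.-tuple (seq nat)) : Prop :=
  forall i : 'I_#|D|.+1,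
    size (tnth la i) = #|block i| /\ sorted geq (tnth la i).

Definition D_schur (n : nat) (D : {set 'I_n})
    (la : #|D|.+1.-tuple (seq nat)) : {mpoly int[n]} :=
  \prod_(i < #|D|.+1) schur (block i) (tnth la i).

Definition is_D_schur_expansion (n : nat) (D : {set 'I_n})
    (f : {mpoly int[n]})
    (c : {fsfun #|D|.+1.-tuple (seq nat) -> int with 0}) : Prop :=
  (forall la, la \in finsupp c -> is_D_partition la) /\
  f = \sum_(la <- finsupp c) c la *: D_schur la.

(* The coefficient family is unique, the D-Schur polynomials being a basis. *)
Definition D_multiplicity_free (n : nat) (D : {set 'I_n})
    (f : {mpoly int[n]}) : Prop :=
  split_symmetric D f /\
  exists2 c : {fsfun #|D|.+1.-tuple (seq nat) -> int with 0},
    is_D_schur_expansion f c & forall la, c la = 0 \/ c la = 1.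

Lemma msym_tpermK (n : nat) (i j : 'I_n) (f : {mpoly int[n]}) :
  msym (tperm i j) (msym (tperm i j) f) = f.
Proof. by rewrite -msymMm tperm2 msym1m. Qed.

Lemma msym_tperm_X (n : nat) (i j k : 'I_n) :
  msym (tperm i j) 'X_k = 'X_(tperm i j k) :> {mpoly int[n]}.
Proof.
rewrite msymX tpermV; congr 'X_[_].
apply/mnmP=> x; rewrite mnmE !mnm1E; congr (nat_of_bool _).
by apply/eqP/eqP=> [->|<-]; rewrite tpermK.
Qed.

Lemma demazureP (n : nat) (i j : 'I_n) (f : {mpoly int[n]}) :
  ('X_i - 'X_j) * demazure i j f = 'X_i * f - 'X_j * msym (tperm i j) f.
Proof.
suff H : exists g, ('X_i - 'X_j) * g = 'X_i * f - 'X_j * msym (tperm i j) f.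
  exact: (epsilon_spec (inhabits 0) _ H).
pose P (p : {mpoly int[n]}) :=
  exists g, p - msym (tperm i j) p = ('X_i - 'X_j) * g.
suff [g gE]: P f.
  exists (f + 'X_j * g).
  by rewrite mulrDr mulrCA -gE; ring.
have PX k : P 'X_k.
  rewrite /P msym_tperm_X.
  by case: tpermP => [->|->|_ _]; [exists 1|exists (-1)|exists 0]; ring.
have P1 : P 1 by exists 0; rewrite msym1; ring.
have PM p q : P p -> P q -> P (p * q).
  move=> [g gE] [h hE]; exists (g * q + msym (tperm i j) p * h).
  rewrite mulrDr mulrA -gE mulrCA -hE msymM; ring.
elim/mpolyind: f => [|c m p _ _ [g gE]]; first by exists 0; rewrite msym0; ring.
have [h hE] : P 'X_[m].
  rewrite mpolyXE_id; apply: big_ind => // k _.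
  by elim: (m k) => [|e IH]; rewrite ?expr0 // exprS; apply: PM.
exists (c *: h + g).
rewrite msymD msymZ mulrDr -gE -scalerAr -hE scalerBr; ring.
Qed.

Lemma mpolyX_sub_neq0 (n : nat) (i j : 'I_n) :
  i != j -> 'X_i - 'X_j != 0 :> {mpoly int[n]}.
Proof.
move=> ij; apply/eqP=> /(congr1 (fun p : {mpoly int[n]} => p@_U_(i))).
rewrite mcoeffB !mcoeffX eqxx mcoeff0; case: eqP => // /mnmP/(_ i).
by rewrite !mnm1E eqxx eq_sym (negPf ij).
Qed.

Lemma demazure_unique (n : nat) (i j : 'I_n) (f g : {mpoly int[n]}) : i != j ->
  ('X_i - 'X_j) * g = 'X_i * f - 'X_j * msym (tperm i j) f ->
  g = demazure i j f.
Proof.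
by move=> ij; rewrite -demazureP => /(mulfI (mpolyX_sub_neq0 ij)).
Qed.

Lemma demazure_sym (n : nat) (i j : 'I_n) (f : {mpoly int[n]}) : i != j ->
  msym (tperm i j) (demazure i j f) = demazure i j f.
Proof.
move=> ij; apply: demazure_unique => //.
apply: oppr_inj; have := congr1 (msym (tperm i j)) (demazureP i j f).
rewrite !msymM !msymB !msymM msym_tpermK !msym_tperm_X tpermL tpermR => E.
by rewrite -mulNr opprB E; ring.
Qed.

Lemma commute_identity (R : comNzRingType) (x y u v f af bf w A bA D aD : R) :
  (u - v) * D = u * f - v * bf -> (u - v) * aD = u * af - v * w ->
  (x - y) * A = x * f - y * af -> (x - y) * bA = x * bf - y * w ->
  (u - v) * (x * D - y * aD) = (x - y) * (u * A - v * bA).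
Proof.
move=> eD eaD eA ebA.
transitivity (x * ((u - v) * D) - y * ((u - v) * aD)); first by ring.
transitivity (u * ((x - y) * A) - v * ((x - y) * bA)); last by ring.
by rewrite eD eaD eA ebA; ring.
Qed.

Lemma demazureC (n : nat) (i j k l : 'I_n) (f : {mpoly int[n]}) :
  uniq [:: i; j; k; l] ->
  demazure i j (demazure k l f) = demazure k l (demazure i j f).
Proof.
rewrite /= !inE !negb_or -!andbA => /and4P[ij ik il /and3P[jk jl /andP[kl _]]].
apply: demazure_unique => //.
apply: (mulfI (mpolyX_sub_neq0 ij)).
have [ki li kj lj] : [/\ k != i, l != i, k != j & l != j].
  by split; rewrite eq_sym.
have Dij := demazureP i j (demazure k l f).
have Dkl := demazureP k l f.
have E1 := demazureP i j f.
have := congr1 (msym (tperm k l)) E1.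
rewrite !(msymM, msymB) !msym_tperm_X !tpermD // => E2.
have := congr1 (msym (tperm i j)) Dkl.
rewrite !(msymM, msymB) !msym_tperm_X !tpermD // => E3.
have sC : msym (tperm k l) (msym (tperm i j) f) =
          msym (tperm i j) (msym (tperm k l) f).
  by rewrite -!msymMm conjgC tpermJ !tpermD.
rewrite sC in E2.
by rewrite mulrCA Dij; apply: commute_identity Dkl E3 E1 E2.
Qed.

Lemma braid_identity (R : comNzRingType)
    (x y z f af bf baf abf w A bA abA B aB C D aD baD E bE F : R) :
  (x - y) * A = x * f - y * af -> (x - z) * bA = x * bf - z * baf ->
  (y - z) * abA = y * abf - z * w ->
  (y - z) * B = y * A - z * bA -> (x - z) * aB = x * A - z * abA ->
  (x - y) * C = x * B - y * aB ->
  (y - z) * D = y * f - z * bf -> (x - z) * aD = x * af - z * abf ->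
  (x - y) * baD = x * baf - y * w ->
  (x - y) * E = x * D - y * aD -> (x - z) * bE = x * D - z * baD ->
  (y - z) * F = y * E - z * bE ->
  (x - y) * (x - z) * (y - z) * C = (x - y) * (x - z) * (y - z) * F.
Proof.
move=> eA ebA eabA eB eaB eC eD eaD ebaD eE ebE eF.
transitivity (x * y * (x * f - y * af) - x * z * (x * bf - z * baf)
  + y * z * (y * abf - z * w)).
  rewrite -eA -ebA -eabA.
  transitivity ((x - z) * (y - z) * ((x - y) * C)); first by ring.
  rewrite eC.
  transitivity (x * (x - z) * ((y - z) * B) - y * (y - z) * ((x - z) * aB)).
    by ring.
  by rewrite eB eaB; ring.
transitivity ((x - y) * (x - z) * ((y - z) * F)); last by ring.
rewrite eF.
transitivity (y * (x - z) * ((x - y) * E) - z * (x - y) * ((x - z) * bE));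
  last by ring.
rewrite eE ebE.
transitivity (x ^+ 2 * ((y - z) * D) - y ^+ 2 * ((x - z) * aD)
  + z ^+ 2 * ((x - y) * baD)); last by ring.
by rewrite eD eaD ebaD; ring.
Qed.

Lemma demazure_braid (n : nat) (i j k : 'I_n) (f : {mpoly int[n]}) :
  uniq [:: i; j; k] ->
  demazure i j (demazure j k (demazure i j f)) =
  demazure j k (demazure i j (demazure j k f)).
Proof.
rewrite /= !inE negb_or -!andbA => /and3P[ij ik /andP[jk _]].
have [ji ki kj] : [/\ j != i, k != i & k != j] by split; rewrite eq_sym.
pose a := msym (tperm i j) : {mpoly int[n]} -> {mpoly int[n]}.
pose b := msym (tperm j k) : {mpoly int[n]} -> {mpoly int[n]}.
have aba : a (b (a f)) = b (a (b f)).
  rewrite /a /b -!msymMm; congr (msym _ f).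
  transitivity (tperm i k).
    by rewrite -{1}[tperm i j]tpermV -conjgE tpermJ tpermR tpermD.
  by rewrite -{1}[tperm j k]tpermV -conjgE tpermJ tpermL tpermD.
have aX p q r : ('X_i - 'X_k) * p = 'X_i * q - 'X_k * r ->
    ('X_j - 'X_k) * a p = 'X_j * a q - 'X_k * a r.
  by move=> /(congr1 a); rewrite /a !(msymM, msymB) !msym_tperm_X tpermL tpermD.
have aY p q r : ('X_j - 'X_k) * p = 'X_j * q - 'X_k * r ->
    ('X_i - 'X_k) * a p = 'X_i * a q - 'X_k * a r.
  by move=> /(congr1 a); rewrite /a !(msymM, msymB) !msym_tperm_X tpermR tpermD.
have bX p q r : ('X_i - 'X_j) * p = 'X_i * q - 'X_j * r ->
    ('X_i - 'X_k) * b p = 'X_i * b q - 'X_k * b r.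
  by move=> /(congr1 b); rewrite /b !(msymM, msymB) !msym_tperm_X tpermL tpermD.
have bY p q r : ('X_i - 'X_k) * p = 'X_i * q - 'X_k * r ->
    ('X_i - 'X_j) * b p = 'X_i * b q - 'X_j * b r.
  by move=> /(congr1 b); rewrite /b !(msymM, msymB) !msym_tperm_X tpermR tpermD.
have aP g : ('X_i - 'X_j) * demazure i j g = 'X_i * g - 'X_j * a g.
  exact: demazureP.
have bP g : ('X_j - 'X_k) * demazure j k g = 'X_j * g - 'X_k * b g.
  exact: demazureP.
have aS g : a (demazure i j g) = demazure i j g by exact: demazure_sym.
have bS g : b (demazure j k g) = demazure j k g by exact: demazure_sym.
have xyz0 : ('X_i - 'X_j) * ('X_i - 'X_k) * ('X_j - 'X_k) != 0 :> {mpoly int[n]}.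
  by rewrite !mulf_neq0 ?mpolyX_sub_neq0.
apply: (mulfI xyz0).
have eA := aP f; have ebA := bX _ _ _ eA; have eabA := aX _ _ _ ebA.
have eB := bP (demazure i j f); have eaB := aY _ _ _ eB; rewrite aS in eaB.
have eC := aP (demazure j k (demazure i j f)).
have eD := bP f; have eaD := aY _ _ _ eD; have ebaD := bY _ _ _ eaD.
have eE := aP (demazure j k f); have ebE := bX _ _ _ eE; rewrite bS in ebE.
have eF := bP (demazure i j (demazure j k f)).
rewrite aba in eabA.
exact: (braid_identity eA ebA eabA eB eaB eC eD eaD ebaD eE ebE eF).
Qed.

Definition entry_weight (n : nat) (alpha : n.-tuple nat) : nat :=
  (\sum_(x < n) x * tnth alpha x)%N.

Lemma swap_entries_weight (n : nat) (i j : 'I_n) (alpha : n.-tuple nat) :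
  j = i.+1 :> nat -> (tnth alpha i < tnth alpha j)%N ->
  (entry_weight (swap_entries i j alpha) < entry_weight alpha)%N.
Proof.
move=> ji lt_a; have ij : j != i by apply/eqP=> E; subst; lia.
rewrite /entry_weight [ltnLHS](bigD1 i) //= [ltnRHS](bigD1 i) //=.
rewrite [X in (_ + X < _)%N](bigD1 j) //= [X in (_ < _ + X)%N](bigD1 j) //=.
rewrite !tnth_mktuple tpermL tpermR ji.
rewrite (eq_bigr (fun x : 'I_n => x * tnth alpha x)%N) => [|x /andP[xi xj]].
  by nia.
by rewrite tnth_mktuple tpermD 1?eq_sym.
Qed.

Lemma is_key_exists (n : nat) (alpha : n.-tuple nat) :
  exists f, is_key alpha f.
Proof.
have [m] := ubnP (entry_weight alpha); elim: m alpha => // m IH alpha lt_m.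
have [[i [j [ji lt_a]]]|no_asc] := classic (exists i j : 'I_n,
    j = i.+1 :> nat /\ (tnth alpha i < tnth alpha j)%N).
  have [|f key_f] := IH (swap_entries i j alpha).
    by apply: leq_trans (swap_entries_weight ji lt_a) _.
  by exists (demazure i j f); apply: is_key_ascent.
exists 'X_[Multinom alpha]; apply: is_key_dominant.
apply/(sortedP 0%N) => x; rewrite size_tuple => lt_x; rewrite /geq /= leqNgt.
apply/negP=> lt_a; apply: no_asc.
by exists (Ordinal (ltnW lt_x)), (Ordinal lt_x); rewrite !(tnth_nth 0%N).
Qed.

Lemma swap_entriesE (n : nat) (i j x : 'I_n) (alpha : n.-tuple nat) :
  tnth (swap_entries i j alpha) x = tnth alpha (tperm i j x).
Proof. by rewrite tnth_mktuple. Qed.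

Lemma is_key_unique (n : nat) (alpha : n.-tuple nat) (f g : {mpoly int[n]}) :
  is_key alpha f -> is_key alpha g -> f = g.
Proof.
have [m] := ubnP (entry_weight alpha).
elim: m alpha f g => // m IH alpha f g lt_m.
have noasc (be : n.-tuple nat) (i j : 'I_n) : sorted geq be ->
    j = i.+1 :> nat -> (tnth be i < tnth be j)%N -> False.
  move=> /(sortedP 0%N) so ji; have := so i; rewrite size_tuple -ji ltn_ord.
  by rewrite !(tnth_nth 0%N) => /(_ isT); rewrite /geq /= leqNgt => /negP.
have next (be : n.-tuple nat) (i j : 'I_n) : j = i.+1 :> nat ->
    (tnth be i < tnth be j)%N -> (entry_weight be < m.+1)%N ->
    (entry_weight (swap_entries i j be) < m)%N.
  by move=> ji lt_a w; apply: leq_trans (swap_entries_weight ji lt_a) _.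
move=> kf kg.
case: kf lt_m kg => {alpha f} [alpha so|alpha i j f ji lt_ij kf] lt_m kg.
  case: kg so {lt_m} => {alpha g} [//|alpha i j g ji lt_ij _] so.
  by case: (noasc _ _ _ so ji lt_ij).
have IHf := IH _ _ _ (next _ _ _ ji lt_ij lt_m) kf.
case: kg ji lt_ij kf lt_m IHf => {alpha g} [alpha so|alpha k l g lk lt_kl kg].
  by move=> ji lt_ij; case: (noasc _ _ _ so ji lt_ij).
move=> ji lt_ij kf lt_m IHf.
have IHg := IH _ _ _ (next _ _ _ lk lt_kl lt_m) kg.
wlog le_ik : i j k l f g ji lt_ij kf lk lt_kl kg IHf IHg / (i <= k)%N.
  move=> W; case: (leqP i k) => [|/ltnW] le; first exact: W le.
  by symmetry; apply: W le.
have [E|ik] := eqVneq i k.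
  subst k; have E : l = j by apply: val_inj; rewrite /= lk ji.
  by subst l; rewrite (IHf _ kg).
have ij : i != j by apply/eqP=> E; subst; lia.
have kl : k != l by apply/eqP=> E; subst; lia.
have lt_ik : (i < k)%N by rewrite ltn_neqAle le_ik andbT.
have [E|jk] := eqVneq j k.
  subst k.
  have il : i != l by apply/eqP=> E; subst; lia.
  pose A := swap_entries i j alpha; pose A1 := swap_entries j l A.
  pose B := swap_entries j l alpha; pose B1 := swap_entries i j B.
  have [h kh] := is_key_exists (swap_entries i j A1).
  have [ji' lj' li'] : [/\ j != i, l != j & l != i] by split; rewrite eq_sym.
  have EAB : swap_entries j l B1 = swap_entries i j A1.
    apply: eq_from_tnth => x; rewrite !swap_entriesE; congr tnth.
    rewrite -!permM; congr (fun_of_perm _ x).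
    transitivity (tperm i l).
      by rewrite -{1}[tperm j l]tpermV -conjgE tpermJ tpermL tpermD.
    by rewrite -{1}[tperm i j]tpermV -conjgE tpermJ tpermR tpermD.
  have lt_il := ltn_trans lt_ij lt_kl.
  have kA1 : is_key A1 (demazure i j h).
    apply: is_key_ascent => //; rewrite /A1 /A !swap_entriesE.
    by rewrite ?(tpermD ji' li') ?tpermL ?(tpermD il kl) ?(tpermD ji' li') ?tpermL.
  have kA : is_key A (demazure j l (demazure i j h)).
    apply: is_key_ascent => //; rewrite /A !swap_entriesE.
    by rewrite ?(tpermD il kl) ?tpermR ?(tpermD ji' li') ?(tpermD il kl) ?tpermR.
  have kB1 : is_key B1 (demazure j l h).
    apply: is_key_ascent; rewrite ?EAB // /B1 /B !swap_entriesE.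
    by rewrite ?(tpermD il kl) ?tpermR ?(tpermD ji' li') ?(tpermD il kl) ?tpermR.
  have kB : is_key B (demazure i j (demazure j l h)).
    apply: is_key_ascent => //; rewrite /B !swap_entriesE.
    by rewrite ?(tpermD ji' li') ?tpermL ?(tpermD il kl) ?(tpermD ji' li') ?tpermL.
  rewrite (IHf _ kA) (IHg _ kB); apply: demazure_braid.
  by rewrite /= !inE negb_or ij il kl.
have il : i != l by apply/eqP=> E; subst; lia.
have jl : j != l by rewrite -val_eqE /= ji lk eqSS.
have [ki' li' kj' lj'] : [/\ k != i, l != i, k != j & l != j].
  by split; rewrite eq_sym.
pose A := swap_entries i j alpha; pose B := swap_entries k l alpha.
have [h kh] := is_key_exists (swap_entries k l A).
have EAB : swap_entries i j B = swap_entries k l A.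
  apply: eq_from_tnth => x; rewrite !swap_entriesE; congr tnth.
  by rewrite -!permM conjgC tpermJ !tpermD.
have kA : is_key A (demazure k l h).
  by apply: is_key_ascent => //; rewrite !swap_entriesE !tpermD.
have kB : is_key B (demazure i j h).
  apply: is_key_ascent; rewrite ?EAB //.
  by rewrite !swap_entriesE !tpermD.
rewrite (IHf _ kA) (IHg _ kB); apply: demazureC.
by rewrite /= !inE !negb_or ij ik il jk jl kl.
Qed.

Lemma key_spec (n : nat) (alpha : n.-tuple nat) : is_key alpha (key alpha).
Proof. exact: (epsilon_spec (inhabits 0) _ (is_key_exists alpha)). Qed.

(* Main.v *)
Require Import Defs.
From mathcomp Require Import all_boot all_order all_fingroup all_algebra.
From mathcomp Require Import finmap zify.

Set Implicit Arguments.
Unset Strict Implicit.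
Unset Printing Implicit Defensive.

Import Order.TTheory GRing.Theory Num.Theory.

(** Sort the entries of alpha decreasingly into a partition lambda, ties staying
in order. The pattern (0, 1, 2) and the four-letter patterns together say that
alpha has no three entries in strictly increasing order, and never two entries
followed by two others each exceeding both of them ([almost_dominant]). Distinct
entries cannot form (0, 0, 1, 1), so alternative (I) gives this as well as (II).
Up to reversal, this is avoidance of 321 and 3412 by the permutation taking
lambda to alpha, i.e. this permutation is a product of pairwise distinct simple
transpositions.

Hence the key polynomial is obtained from x^lambda by Demazure operators with
distinct indices. Each operator replaces a monomial by its string in the
direction of one simple root; the roots are independent, so no monomial arises
twice and every coefficient is 0 or 1. The support consists of the vectors
lambda - sum_j v_j (eps_(j-1) - eps_j), where 0 <= v_j is at most
lambda_(j-1) - lambda_j plus those neighbours v_(j-1), v_(j+1) whose operators act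
earlier. The entries of alpha tell which operators these are ([admissible]), and
[mcoeff_is_key] follows by induction along the exchanges of ascents.

On a block of D, alpha increases weakly, so it takes at most two values there,
and if it takes two, one of them occurs once. It turns out that the inequalities
at the inner cuts of the block then say that its exponents are all at least, or
all at most, a bound depending only on the values of v at cuts of D
([admissible_in_box], [in_box_admissible]). The values of v at the cuts of D
amount to the degrees of the monomial in the blocks. So the monomials of the
support with prescribed block degrees form a product of boxes. In p variables,
the box of all m of degree s with m_i >= a is the support of the Schur
polynomial of (s - (p-1)a, a, ..., a), and the box with m_i <= b is that of
(b, ..., b, s - (p-1)b); all Kostka numbers of these shapes are 0 or 1, since a
Gelfand-Tsetlin pattern of such a shape has one free row at each step
([mcoeff_schur_box]). The key polynomial is thus the sum of one D-Schur
polynomial for each tuple of block degrees that occurs, and D-Schur polynomials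
with different block degrees are different. *)

(** * Pattern avoidance *)

Lemma contains_pattern_nth (a b js : seq nat) :
  size js = size b -> all (fun j => j < size a) js -> sorted ltn js ->
  (forall s t, s < size b -> t < size b ->
    ((nth 0%N a (nth 0%N js s) <= nth 0%N a (nth 0%N js t)) =
      (nth 0%N b s <= nth 0%N b t)) /\
    (`|(nth 0%N b s)%:Z - (nth 0%N b t)%:Z| <=
      `|(nth 0%N a (nth 0%N js s))%:Z - (nth 0%N a (nth 0%N js t))%:Z|)%R) ->
  contains_pattern a b.
Proof.
move=> sz /(all_nthP 0) lt_js srt H.
have lt_s (s : 'I_(size b)) : nth 0%N js s < size a by apply: lt_js; rewrite sz.
exists (fun s => Ordinal (lt_s s)) => [s t st|s t]; last exact: H.
by apply: (sorted_ltn_nth ltn_trans 0 srt); rewrite ?inE ?sz.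
Qed.

(** The ties are included: with equal entries read as decreasing from left to
right, this says that the standardization of alpha avoids 012 and 1032. *)
Definition almost_dominant (n : nat) (alpha : n.-tuple nat) : Prop :=
  (forall x y z, x < y -> y < z -> z < n ->
    nth 0%N alpha x < nth 0%N alpha y -> nth 0%N alpha y < nth 0%N alpha z -> False) /\
  (forall x1 x2 y1 y2, x1 < x2 -> x2 < y1 -> y1 < y2 -> y2 < n ->
    maxn (nth 0%N alpha x1) (nth 0%N alpha x2) <
    minn (nth 0%N alpha y1) (nth 0%N alpha y2) -> False).

(** Once (0, 1, 2) is excluded, each of the two pairs in a forbidden configuration
is weakly decreasing, and which pairs are ties decides which four-letter pattern
it forms. Distinct entries leave no tie, so (0, 0, 1, 1) does not occur under (I). *)
Lemma avoidance_almost_dominant (n : nat) (alpha : n.-tuple nat) :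
  avoids alpha [:: 0; 1; 2] -> avoids alpha [:: 0; 0; 2; 1] ->
  avoids alpha [:: 1; 0; 3; 2] -> avoids alpha [:: 1; 0; 2; 2] ->
  (forall i j : 'I_n, i != j -> tnth alpha i != tnth alpha j) \/
    avoids alpha [:: 0; 0; 1; 1] ->
  almost_dominant alpha.
Proof.
move=> av012 av0021 av1032 av1022 I_or_II.
have no012 x y z : x < y -> y < z -> z < n ->
    nth 0%N alpha x < nth 0%N alpha y -> nth 0%N alpha y < nth 0%N alpha z -> False.
  move=> xy yz zn axy ayz; apply: av012.
  apply: (@contains_pattern_nth _ _ [:: x; y; z]) => //=.
  - by rewrite size_tuple; lia.
  - by rewrite xy yz.
  - by case=> [|[|[|s]]]; case=> [|[|[|t]]] //= _ _; split; lia.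
split=> // x1 x2 y1 y2 x12 xy y12 yn; set a1 := nth 0%N alpha x1.
set a2 := nth 0%N alpha x2; set b1 := nth 0%N alpha y1; set b2 := nth 0%N alpha y2.
move=> ab.
have a21 : a2 <= a1.
  by rewrite leqNgt; apply/negP=> a12; apply: (no012 x1 x2 y1) => //; lia.
have b21 : b2 <= b1.
  by rewrite leqNgt; apply/negP=> b12; apply: (no012 x1 y1 y2) => //; lia.
have all_lt : all (fun j => j < size alpha) [:: x1; x2; y1; y2].
  by rewrite /= size_tuple; lia.
have srt : sorted ltn [:: x1; x2; y1; y2] by rewrite /= x12 xy y12.
have [a_eq|a_neq] := eqVneq a1 a2; have [b_eq|b_neq] := eqVneq b1 b2.
- case: I_or_II => [inj|av0011].
    have x1n : x1 < n by lia.
    have x2n : x2 < n by lia.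
    have /negP[] := inj (Ordinal x1n) (Ordinal x2n) ltac:(rewrite -val_eqE /=; lia).
    by rewrite !(tnth_nth 0) /=; apply/eqP.
  apply: av0011; apply: (@contains_pattern_nth _ _ [:: x1; x2; y1; y2]) => //.
  by case=> [|[|[|[|s]]]]; case=> [|[|[|[|t]]]] //= _ _;
    rewrite -/a1 -/a2 -/b1 -/b2; split; lia.
- apply: av0021; apply: (@contains_pattern_nth _ _ [:: x1; x2; y1; y2]) => //.
  by case=> [|[|[|[|s]]]]; case=> [|[|[|[|t]]]] //= _ _;
    rewrite -/a1 -/a2 -/b1 -/b2; split; lia.
- apply: av1022; apply: (@contains_pattern_nth _ _ [:: x1; x2; y1; y2]) => //.
  by case=> [|[|[|[|s]]]]; case=> [|[|[|[|t]]]] //= _ _;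
    rewrite -/a1 -/a2 -/b1 -/b2; split; lia.
- apply: av1032; apply: (@contains_pattern_nth _ _ [:: x1; x2; y1; y2]) => //.
  by case=> [|[|[|[|s]]]]; case=> [|[|[|[|t]]]] //= _ _;
    rewrite -/a1 -/a2 -/b1 -/b2; split; lia.
Qed.

(** * Demazure strings in distinct directions *)

Definition smaller_before (n : nat) (alpha : n.-tuple nat) (x : nat) : bool :=
  [exists y : 'I_n, (y < x) && (nth 0%N alpha y < nth 0%N alpha x)].

Definition larger_after (n : nat) (alpha : n.-tuple nat) (x : nat) : bool :=
  [exists y : 'I_n, (x < y) && (nth 0%N alpha x < nth 0%N alpha y)].

(** The crossed cuts are the indices of the Demazure operators that lead from the
sorted rearrangement to alpha; cut j separates the positions below j from the
others, and its operator involves the variables at j.-1 and j. *)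
Definition crossed (n : nat) (alpha : n.-tuple nat) (j : nat) : bool :=
  [exists x : 'I_n, exists y : 'I_n,
    [&& x < j, j <= y & nth 0%N alpha x < nth 0%N alpha y]].

Definition sorted_entry (n : nat) (alpha : n.-tuple nat) (x : nat) : nat :=
  nth 0%N (sort geq alpha) x.

Lemma smaller_beforeP (n : nat) (alpha : n.-tuple nat) (x : nat) :
  reflect (exists y, [/\ y < x, x < n & nth 0%N alpha y < nth 0%N alpha x])
    (smaller_before alpha x).
Proof.
apply: (iffP existsP) => [[y /andP[yx lt_a]]|[y [yx xn lt_a]]].
  exists y; split=> //; rewrite ltnNge; apply/negP=> nx.
  by rewrite [X in _ < X]nth_default ?size_tuple in lt_a.
by exists (Ordinal (ltn_trans yx xn)); rewrite /= yx.
Qed.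

Lemma larger_afterP (n : nat) (alpha : n.-tuple nat) (x : nat) :
  reflect (exists y, [/\ x < y, y < n & nth 0%N alpha x < nth 0%N alpha y])
    (larger_after alpha x).
Proof.
apply: (iffP existsP) => [[y /andP[xy lt_a]]|[y [xy yn lt_a]]].
  by exists y.
by exists (Ordinal yn); rewrite /= xy.
Qed.

Lemma crossedP (n : nat) (alpha : n.-tuple nat) (j : nat) :
  reflect (exists x y, [/\ x < j, j <= y, y < n &
      nth 0%N alpha x < nth 0%N alpha y])
    (crossed alpha j).
Proof.
apply: (iffP existsP) => [[x /existsP[y /and3P[xj jy lt_a]]]|].
  by exists x, y.
case=> x [y [xj jy yn lt_a]].
have xn : x < n by lia.
by exists (Ordinal xn); apply/existsP; exists (Ordinal yn); rewrite /= xj jy.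
Qed.

(** The coordinate v j counts how often the simple root at cut j is subtracted from
the sorted rearrangement. Its upper bound is the length of the string produced
by the operator at j, to which v j.-1 (resp. v j.+1) contributes if the
operator of that cut acts earlier. The entry between the two cuts reveals the
order: if it is smaller than a later entry, a large entry has travelled to the
right, through cut j.-1 first; if it is larger than an earlier entry, a small
one has travelled to the left, through cut j.+1 first. *)
Definition admissible (n : nat) (alpha : n.-tuple nat) (v : nat -> int) : bool :=
  [forall j : 'I_n.+1,
    if crossed alpha j then
      (0 <= v j)%R &&
      (v j <= (sorted_entry alpha j.-1)%:Z - (sorted_entry alpha j)%:Z
              + (if larger_after alpha j.-1 then v j.-1 else 0)
              + (if smaller_before alpha j then v j.+1 else 0))%R
    else v j == 0].

Lemma admissibleP (n : nat) (alpha : n.-tuple nat) (v : nat -> int) :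
  reflect
    (forall j, j <= n ->
      (~~ crossed alpha j -> v j = 0) /\
      (crossed alpha j -> (0 <= v j)%R /\
        (v j <= (sorted_entry alpha j.-1)%:Z - (sorted_entry alpha j)%:Z
              + (if larger_after alpha j.-1 then v j.-1 else 0)
              + (if smaller_before alpha j then v j.+1 else 0))%R))
    (admissible alpha v).
Proof.
apply: (iffP forallP) => [H j jn|H [j jn]] /=.
  have jn1 : j < n.+1 by [].
  have /= := H (Ordinal jn1); case: ifP => // _; last by move/eqP.
  by move/andP.
by have [H1 H2] := H j jn; case: ifP => [/H2/andP//|/negbT/H1/eqP].
Qed.

Lemma crossed_bounds (n : nat) (alpha : n.-tuple nat) (j : nat) :
  crossed alpha j -> 0 < j < n.
Proof. by move=> /crossedP[x [y [*]]]; lia. Qed.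

Lemma admissible_ge0 (n : nat) (alpha : n.-tuple nat) (v : nat -> int) (j : nat) :
  admissible alpha v -> j <= n -> (0 <= v j)%R.
Proof.
move=> /admissibleP H /H[H1 H2].
by case: (boolP (crossed alpha j)) => [/H2[]//|/H1 ->].
Qed.

Lemma eq_admissible (n : nat) (alpha : n.-tuple nat) (v w : nat -> int) :
  (forall j, j <= n -> v j = w j) -> admissible alpha v = admissible alpha w.
Proof.
move=> vw; apply: eq_forallb => j; rewrite vw -1?ltnS //.
case: ifP => // /crossed_bounds /andP[j0 jn].
by rewrite (vw j.-1) ?(vw j.+1) //; lia.
Qed.

Definition set_cut (v : nat -> int) (k : nat) (z : int) : nat -> int :=
  fun x => if x == k then z else v x.

Definition swap_pos (i j x : nat) : nat :=
  if x == i then j else if x == j then i else x.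

Lemma swap_posK (i j : nat) : involutive (swap_pos i j).
Proof.
move=> x; rewrite /swap_pos; have [->|xi] := eqVneq x i.
  by rewrite eqxx; case: eqP.
by have [->|xj] := eqVneq x j; rewrite ?eqxx // (negPf xi) (negPf xj).
Qed.

Lemma swap_pos_lt (i j k x : nat) : j = i.+1 -> k != j ->
  (swap_pos i j x < k) = (x < k).
Proof. by move=> ji kj; rewrite /swap_pos; case: eqP => ?; [|case: eqP => ?]; lia. Qed.

Lemma nth_swap_entries (n : nat) (alpha : n.-tuple nat) (i j : 'I_n) (x : nat) :
  nth 0%N (swap_entries i j alpha) x = nth 0%N alpha (swap_pos i j x).
Proof.
rewrite /swap_pos; have [xn|nx] := ltnP x n; last first.
  rewrite nth_default ?size_tuple //; case: eqP => [xi|_].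
    by have := ltn_ord i; lia.
  case: eqP => [xj|_]; first by have := ltn_ord j; lia.
  by rewrite nth_default ?size_tuple.
rewrite -(tnth_nth 0%N _ (Ordinal xn)) swap_entriesE (tnth_nth 0).
congr nth; case: tpermP => [<-|<-|] /=; rewrite ?eqxx //.
  by case: eqP.
by move=> /eqP; rewrite -val_eqE /= => /negPf-> /eqP; rewrite -val_eqE /= => /negPf->.
Qed.

Lemma sorted_entry_swap (n : nat) (alpha : n.-tuple nat) (i j : 'I_n) (x : nat) :
  sorted_entry (swap_entries i j alpha) x = sorted_entry alpha x.
Proof.
rewrite /sorted_entry; congr nth; apply/perm_sortP.
- by move=> a b; apply: leq_total.
- by move=> a b c ab bc; apply: leq_trans bc ab.
- by move=> a b; rewrite andbC; apply: anti_leq.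
by apply/tuple_permP; exists (tperm i j); congr val; apply: eq_from_tnth => y;
  rewrite !tnth_mktuple.
Qed.

Lemma sorted_entry_anti (n : nat) (alpha : n.-tuple nat) (x y : nat) :
  x <= y -> sorted_entry alpha y <= sorted_entry alpha x.
Proof.
move=> xy; have [yn|ny] := ltnP y n; last first.
  by rewrite /sorted_entry nth_default // size_sort size_tuple.
have srt := sort_sorted (fun a b => leq_total b a) alpha.
have geq_tr : transitive geq by move=> a b c ab bc; apply: leq_trans bc ab.
have geq_rf : reflexive geq by move=> a; apply: leqnn.
by apply: (sorted_leq_nth geq_tr geq_rf 0%N srt); rewrite ?inE ?size_sort ?size_tuple //;
  lia.
Qed.

Lemma almost_dominant_no22 (n : nat) (alpha : n.-tuple nat) :
  almost_dominant alpha ->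
  forall x1 x2 y1 y2 : nat, x1 != x2 -> y1 != y2 ->
    maxn x1 x2 < minn y1 y2 -> maxn y1 y2 < n ->
    maxn (nth 0%N alpha x1) (nth 0%N alpha x2) <
    minn (nth 0%N alpha y1) (nth 0%N alpha y2) -> False.
Proof.
move=> [_ no22] x1 x2 y1 y2 nx ny xy yn lt_a.
have [x12|x21] := leqP x1 x2; have [y12|y21] := leqP y1 y2.
- by apply: (no22 x1 x2 y1 y2); lia.
- by apply: (no22 x1 x2 y2 y1); lia.
- by apply: (no22 x2 x1 y1 y2); lia.
- by apply: (no22 x2 x1 y2 y1); lia.
Qed.

(** Exchanging an ascent creates no new increasing pair: two positions whose
entries increase after the exchange come from two positions, in the same order,
whose entries increased before. *)
Lemma almost_dominant_swap (n : nat) (alpha : n.-tuple nat) (i j : 'I_n) :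
  j = i.+1 :> nat -> tnth alpha i < tnth alpha j ->
  almost_dominant alpha -> almost_dominant (swap_entries i j alpha).
Proof.
move=> ji; rewrite !(tnth_nth 0) => lt_ij good; have jn := ltn_ord j.
have no22 := almost_dominant_no22 good; case: good => no012 _.
pose s x := swap_pos i j x.
have sE x : nth 0%N (swap_entries i j alpha) x = nth 0%N alpha (s x).
  exact: nth_swap_entries.
have s_lt x y : x < y -> nth 0%N (swap_entries i j alpha) x <
    nth 0%N (swap_entries i j alpha) y -> s x < s y.
  rewrite !sE /s /swap_pos; case: (eqVneq x i) => xi; case: (eqVneq y i) => yi;
    case: (eqVneq x j) => xj; case: (eqVneq y j) => yj; subst; lia.
have s_inj x y : x != y -> s x != s y.
  rewrite /s /swap_pos; case: (eqVneq x i) => xi; case: (eqVneq y i) => yi;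
    case: (eqVneq x j) => xj; case: (eqVneq y j) => yj; subst; lia.
have s_n x : x < n -> s x < n.
  by rewrite /s /swap_pos; case: (eqVneq x i) => xi; case: (eqVneq x j) => xj; subst; lia.
split=> [x y z xy yz zn a1 a2|x1 x2 y1 y2 x12 xy y12 yn lt_a].
  apply: (no012 (s x) (s y) (s z)); rewrite -?sE //; try exact: s_lt.
  exact: s_n.
have l11 := s_lt x1 y1 ltac:(lia) ltac:(lia).
have l12 := s_lt x1 y2 ltac:(lia) ltac:(lia).
have l21 := s_lt x2 y1 ltac:(lia) ltac:(lia).
have l22 := s_lt x2 y2 ltac:(lia) ltac:(lia).
have n1 := s_n y1 ltac:(lia); have n2 := s_n y2 ltac:(lia).
apply: (no22 (s x1) (s x2) (s y1) (s y2)); try (by apply: s_inj; lia); try lia.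
by rewrite -!sE.
Qed.

(** Without (0, 1, 2), the lower entry of an ascent is minimal among the entries up
to it and the upper one maximal among those from it on; so the operator at this
cut acts after both of its neighbours, and neither of them waits for it. *)
Lemma ascent_flags (n : nat) (alpha : n.-tuple nat) (i j : 'I_n) :
  j = i.+1 :> nat -> tnth alpha i < tnth alpha j -> almost_dominant alpha ->
  [/\ crossed alpha j, larger_after alpha i, smaller_before alpha j,
      ~~ smaller_before alpha i & ~~ larger_after alpha j].
Proof.
move=> ji; rewrite !(tnth_nth 0%N) => lt_ij [no012 _]; have jn := ltn_ord j.
split.
- by apply/crossedP; exists i, j; split=> //; lia.
- by apply/larger_afterP; exists j; split=> //; lia.
- by apply/smaller_beforeP; exists i; split=> //; lia.
- apply/smaller_beforeP=> -[y [yi _ lt_a]].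
  by apply: (no012 y i j) => //; lia.
- apply/larger_afterP=> -[y [jy yn lt_a]].
  by apply: (no012 i j y) => //; lia.
Qed.

Lemma crossed_swap (n : nat) (alpha : n.-tuple nat) (i j : 'I_n) (k : nat) :
  j = i.+1 :> nat -> k != j ->
  crossed (swap_entries i j alpha) k = crossed alpha k.
Proof.
move=> ji kj; have jn := ltn_ord j; have nj : n != j by lia.
apply/crossedP/crossedP=> -[x [y [xk ky yn lt_a]]];
  exists (swap_pos i j x), (swap_pos i j y); split; rewrite ?swap_pos_lt //;
  try by rewrite leqNgt swap_pos_lt // -leqNgt.
  by rewrite -!nth_swap_entries.
by rewrite !nth_swap_entries !swap_posK.
Qed.

(** This is where the operators get distinct indices: a pair still crossing the cut
after the exchange would form, with the exchanged pair, an increasing triple or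
two entries followed by two larger ones. *)
Lemma uncrossed_swap (n : nat) (alpha : n.-tuple nat) (i j : 'I_n) :
  j = i.+1 :> nat -> tnth alpha i < tnth alpha j -> almost_dominant alpha ->
  crossed (swap_entries i j alpha) j = false.
Proof.
move=> ji; rewrite !(tnth_nth 0%N) => lt_ij good; have jn := ltn_ord j.
have no22 := almost_dominant_no22 good; case: good => no012 _.
apply/crossedP=> -[x [y [xj jy yn]]]; rewrite !nth_swap_entries.
rewrite /swap_pos; have -> : (y == i) = false by lia.
have -> : (x == j) = false by lia.
case: (eqVneq x i) => [xi|xi]; case: (eqVneq y j) => [yj|yj] lt_a.
- by lia.
- by apply: (no012 i j y); lia.
- by apply: (no012 x i j); lia.
have [ix|xi_lt] := leqP (nth 0%N alpha i) (nth 0%N alpha x); last first.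
  by apply: (no012 x i j); lia.
have [yj'|jy_lt] := leqP (nth 0%N alpha y) (nth 0%N alpha j); last first.
  by apply: (no012 i j y); lia.
by apply: (no22 x i j y); lia.
Qed.

Lemma smaller_before_swap (n : nat) (alpha : n.-tuple nat) (i j : 'I_n) (k : nat) :
  j = i.+1 :> nat -> k != i -> k != j ->
  smaller_before (swap_entries i j alpha) k = smaller_before alpha k.
Proof.
move=> ji ki kj; have jn := ltn_ord j.
have kE : swap_pos i j k = k by rewrite /swap_pos (negPf ki) (negPf kj).
apply/smaller_beforeP/smaller_beforeP=> -[y [yk kn lt_a]];
  exists (swap_pos i j y); split; rewrite ?swap_pos_lt //.
  by rewrite -{1}kE -!nth_swap_entries.
by rewrite -{1}kE !nth_swap_entries !swap_posK.
Qed.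

Lemma larger_after_swap (n : nat) (alpha : n.-tuple nat) (i j : 'I_n) (k : nat) :
  j = i.+1 :> nat -> k != i -> k != j ->
  larger_after (swap_entries i j alpha) k = larger_after alpha k.
Proof.
move=> ji ki kj; have jn := ltn_ord j; have nj : n != j by lia.
have kE : swap_pos i j k = k by rewrite /swap_pos (negPf ki) (negPf kj).
have k1j : k.+1 != j by lia.
apply/larger_afterP/larger_afterP=> -[y [ky yn lt_a]];
  exists (swap_pos i j y); split; rewrite ?swap_pos_lt //;
  try by rewrite ltnNge -ltnS swap_pos_lt // -leqNgt.
  by rewrite -{1}kE -!nth_swap_entries.
by rewrite -{1}kE !nth_swap_entries !swap_posK.
Qed.

(** The operator of an ascent acts last, so it adds one coordinate and leaves the
other inequalities as they were when this coordinate was 0. *)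
Lemma admissible_swap (n : nat) (alpha : n.-tuple nat) (i j : 'I_n)
    (v : nat -> int) :
  j = i.+1 :> nat -> tnth alpha i < tnth alpha j -> almost_dominant alpha ->
  admissible alpha v =
  admissible (swap_entries i j alpha) (set_cut v j 0) &&
  (0 <= v j <= (sorted_entry alpha i)%:Z - (sorted_entry alpha j)%:Z
                + v i + v j.+1)%R.
Proof.
move=> ji lt_ij good; have jn := ltn_ord j.
have [cj ai bj nbi naj] := ascent_flags ji lt_ij good.
have ncj := uncrossed_swap ji lt_ij good.
set beta := swap_entries i j alpha; pose v0 := set_cut v j 0.
have v0E (k : nat) : k != j -> v0 k = v k by rewrite /v0 /set_cut => /negPf->.
have v0j : v0 j = 0%R by rewrite /v0 /set_cut eqxx.
have leftE (k : nat) : k != j -> 0 < k ->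
    (if larger_after beta k.-1 then v0 k.-1 else 0%R) =
    (if larger_after alpha k.-1 then v k.-1 else 0%R).
  move=> kj k0; have [kj1|kj1] := eqVneq k.-1 j.
    by rewrite kj1 v0j (negPf naj); case: ifP.
  by rewrite /beta larger_after_swap ?v0E //; lia.
have rightE (k : nat) : k != j ->
    (if smaller_before beta k then v0 k.+1 else 0%R) =
    (if smaller_before alpha k then v k.+1 else 0%R).
  move=> kj; have [ki|ki] := eqVneq k i.
    by rewrite ki -ji v0j (negPf nbi); case: ifP.
  by rewrite /beta smaller_before_swap ?v0E //; lia.
have i_pred : (j : nat).-1 = i by rewrite ji.
apply/admissibleP/andP=> [H|[/admissibleP H /andP[vj0 vj1]] k kn].
  split.
    apply/admissibleP=> k kn; have [->|kj] := eqVneq k j.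
      by rewrite ncj.
    rewrite /beta crossed_swap // -/beta -/v0.
    have [H1 H2] := H k kn; split=> [|/[dup] /crossed_bounds /andP[k0 _] /H2].
      by rewrite v0E.
    by rewrite leftE // rightE // v0E // !sorted_entry_swap.
  have [_ /(_ cj)] := H j (ltnW jn).
  by rewrite i_pred ai bj => -[-> ->].
have [->|kj] := eqVneq k j.
  by rewrite cj i_pred ai bj.
have := H k kn; rewrite /beta crossed_swap // -/beta -/v0 v0E //.
case=> H1 H2; split=> // /[dup] /crossed_bounds /andP[k0 _] /H2.
by rewrite leftE // rightE // !sorted_entry_swap.
Qed.

(** The exponent of the variable x in the monomial with root coordinates v. *)
Definition exponent (n : nat) (alpha : n.-tuple nat) (v : nat -> int) (x : nat) :
    int := ((sorted_entry alpha x)%:Z + v x - v x.+1)%R.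

Lemma admissible_dominant (n : nat) (alpha : n.-tuple nat) (v : nat -> int) :
  sorted geq alpha -> admissible alpha v = [forall j : 'I_n.+1, v j == 0%R].
Proof.
move=> srt; apply: eq_forallb => j.
suff -> : crossed alpha j = false by [].
apply/crossedP=> -[x [y [xj jy yn]]]; rewrite ltnNge; apply/negP/negPn.
apply: (sorted_leq_nth _ _ 0%N srt); rewrite ?inE ?size_tuple //; try lia.
  by move=> a b c ab bc; apply: leq_trans bc ab.
by move=> a; apply: leqnn.
Qed.

(** The pair of exponents at the last cut lies on the string between an earlier pair
and its mirror image, so it stays nonnegative. *)
Lemma admissible_exponent_ge0 (n : nat) (alpha : n.-tuple nat) :
  almost_dominant alpha ->
  forall v x, admissible alpha v -> x < n -> (0 <= exponent alpha v x)%R.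
Proof.
elim: (key_spec alpha) => {alpha} [alpha srt|alpha i j f ji lt_ij _ IH] good v x.
  rewrite admissible_dominant // => /forallP H xn.
  have x1 : x < n.+1 by lia.
  have /eqP/= v1 := H (Ordinal x1); have /eqP/= v2 := H (Ordinal (xn : x.+1 < n.+1)).
  by rewrite /exponent v1 v2; lia.
rewrite (admissible_swap _ ji lt_ij good) => /andP[adm /andP[v0 v1]] xn.
have {}IH := IH (almost_dominant_swap ji lt_ij good) _ _ adm.
have [jn in'] := (ltn_ord j, ltn_ord i).
have v0E (k : nat) : k != j -> set_cut v j 0 k = v k.
  by rewrite /set_cut => /negPf->.
have := IH j jn; rewrite /exponent !sorted_entry_swap {1}/set_cut eqxx.
rewrite v0E; last by lia.
have [->|xj] := eqVneq x j; first by rewrite /exponent; lia.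
have [->|xi] := eqVneq x i; first by rewrite /exponent -ji; lia.
move=> _; have := IH x xn; rewrite /exponent sorted_entry_swap !v0E //; lia.
Qed.

(** * Monomials of key polynomials *)

Local Open Scope ring_scope.

(** The root coordinates of the monomial m. *)
Definition cut_vector (n : nat) (alpha : n.-tuple nat) (m : 'X_{1..n}) (j : nat) : int :=
  \sum_(x < n | (x < j)%N) ((sorted_entry alpha x)%:Z - (m x)%:Z).

Lemma cut_vector0 (n : nat) (alpha : n.-tuple nat) (m : 'X_{1..n}) :
  cut_vector alpha m 0%N = 0.
Proof. by rewrite /cut_vector big_pred0. Qed.

Lemma cut_vectorS (n : nat) (alpha : n.-tuple nat) (m : 'X_{1..n}) (x : 'I_n) :
  cut_vector alpha m x.+1 =
  cut_vector alpha m x + (sorted_entry alpha x)%:Z - (m x)%:Z.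
Proof.
rewrite /cut_vector (bigD1 x) //= addrC -addrA; congr (_ + _).
by apply: eq_bigl => y; rewrite ltnS ltn_neqAle andbC -val_eqE.
Qed.

Lemma cut_vector_exponent (n : nat) (alpha : n.-tuple nat) (m : 'X_{1..n}) (x : 'I_n) :
  exponent alpha (cut_vector alpha m) x = (m x)%:Z.
Proof. by rewrite /exponent cut_vectorS; lia. Qed.

Lemma sum_Posz (I : Type) (r : seq I) (P : pred I) (F : I -> nat) :
  \sum_(x <- r | P x) (F x)%:Z = (\sum_(x <- r | P x) F x)%N%:Z.
Proof. by rewrite -natz natr_sum; apply: eq_bigr => x _; rewrite natz. Qed.

Lemma cut_vector_max (n : nat) (alpha : n.-tuple nat) (m : 'X_{1..n}) :
  cut_vector alpha m n + (mdeg m)%:Z = (\sum_(x < n) sorted_entry alpha x)%:Z.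
Proof.
rewrite /cut_vector mdegE [X in X + _](eq_bigl xpredT) => [|x]; last exact: ltn_ord.
by rewrite sumrB !sum_Posz subrK.
Qed.

Lemma mcoeffXM (n : nat) (i : 'I_n) (p : {mpoly int[n]}) (m : 'X_{1..n}) :
  ('X_i * p)@_m = if (0 < m i)%N then p@_(m - U_(i)) else 0.
Proof.
have -> : 'X_i * p = p * 'X_i by rewrite mulrC.
case: ifP => [mi|/negbT mi].
  have le_m : (U_(i) <= m)%MM by rewrite lep1mP -lt0n.
  rewrite -[X in _@_X = _](submK le_m). by rewrite addmC mcoeffMX.
rewrite mcoeffM big1 // => k /eqP mE; rewrite mcoeffX.
case: eqP => [kE|_]; last by rewrite mulr0.
by case/negP: mi; rewrite mE mnmDE -kE mnm1E eqxx addn1.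
Qed.

(** Dividing by a variable raises the coordinates at all later cuts by one. *)
Lemma cut_vector_subU (n : nat) (alpha : n.-tuple nat) (m : 'X_{1..n})
    (i : 'I_n) (j : nat) : (0 < m i)%N -> (j <= n)%N ->
  cut_vector alpha (m - U_(i))%MM j = cut_vector alpha m j + ((i < j)%N : nat)%:Z.
Proof.
move=> mi; elim: j => [|j IH] jn; first by rewrite !cut_vector0.
have /= E m' := cut_vectorS alpha m' (Ordinal jn).
rewrite !{}E IH ?(ltnW jn) // mnmBE mnm1E -val_eqE /=.
case: (eqVneq (i : nat) j) => [ij|ij]; last by lia.
have -> : Ordinal jn = i by exact: val_inj.
lia.
Qed.

(** Monomials not divisible by the variable need no separate treatment: for them
the shifted coordinates have a negative exponent, hence are not admissible. *)
Lemma mcoeff_admissible_XM (n : nat) (alpha : n.-tuple nat) (p : {mpoly int[n]})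
    (i : 'I_n) (m : 'X_{1..n}) :
  (forall v x, admissible alpha v -> (x < n)%N -> 0 <= exponent alpha v x) ->
  (forall m, p@_m = (admissible alpha (cut_vector alpha m))%:R) ->
  ('X_i * p)@_m =
    (admissible alpha (fun x => cut_vector alpha m x + ((i < x)%N : nat)%:Z))%:R.
Proof.
move=> nonneg pE; rewrite mcoeffXM; case: ifP => [mi|/negbT mi].
  rewrite pE; congr ((_ : bool)%:R); apply: eq_admissible => j jn.
  exact: cut_vector_subU.
case: (boolP (admissible _ _)) => // /nonneg /(_ (ltn_ord i)).
by rewrite /exponent cut_vectorS; lia.
Qed.

(** Exchanging the exponents on both sides of a cut changes the coordinate at this
cut only: it reflects the string. *)
Lemma cut_vector_tperm (n : nat) (alpha : n.-tuple nat) (m : 'X_{1..n})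
    (i j : 'I_n) (k : nat) : j = i.+1 :> nat -> (k <= n)%N ->
  cut_vector alpha [multinom m (tperm i j x) | x < n] k =
  set_cut (cut_vector alpha m) j
    (cut_vector alpha m i + (sorted_entry alpha i)%:Z - (m j)%:Z) k.
Proof.
move=> ji; elim: k => [|k IH] kn.
  by rewrite /set_cut ji !cut_vector0.
have /= E m' := cut_vectorS alpha m' (Ordinal kn).
rewrite E IH ?(ltnW kn) // mnmE /set_cut.
have [ki|ki] := eqVneq k i.
  have -> : Ordinal kn = i by apply: val_inj.
  have -> : (k.+1 == j) = true by lia.
  have -> : (k == j) = false by lia.
  by rewrite tpermL ki.
have [kj|kj] := eqVneq k j.
  have oj : Ordinal kn = j by apply: val_inj.
  have -> : (k.+1 == j) = false by lia.
  rewrite E oj tpermR kj; have := cut_vectorS alpha m i; rewrite -ji; lia.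
rewrite tpermD ?E; last 2 first.
- by rewrite -val_eqE eq_sym.
- by rewrite -val_eqE eq_sym.
by have -> : (k.+1 == j) = false by lia.
Qed.

(** The telescoping in (x - y) (x^N + x^(N-1) y + ... + y^N) = x^(N+1) - y^(N+1),
with t the position in the string. *)
Lemma indicator_shift (t N : int) : 0 <= N ->
  (0 <= t + 1 <= N)%R%:R - (0 <= t <= N)%R%:R =
  (t + 1 == 0)%R%:R - (t == N)%:R :> int.
Proof.
move=> N0; have [->|tN] := eqVneq t N.
  have -> : (0 <= N + 1 <= N) = false by lia.
  have -> : (0 <= N <= N) = true by lia.
  by have -> : (N + 1 == 0) = false by lia.
have [{}tN|{}tN] : t < N \/ N < t by lia.
  have [t1|t1] := eqVneq (t + 1) 0.
    have -> : (0 <= t <= N) = false by lia.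
    by rewrite t1 N0.
  have -> : (0 <= t + 1 <= N) = (0 <= t <= N) by lia.
  by rewrite subrr.
have -> : (0 <= t + 1 <= N) = false by lia.
have -> : (0 <= t <= N) = false by lia.
by have -> : (t + 1 == 0) = false by lia.
Qed.

(** The polynomial with the claimed coefficients satisfies the defining equation of
the last Demazure operator: comparing coefficients of one monomial, the four
terms differ only in the coordinate at the last cut, where the equation
telescopes. *)
Lemma mcoeff_is_key (n : nat) (alpha : n.-tuple nat) (f : {mpoly int[n]}) :
  is_key alpha f -> almost_dominant alpha ->
  forall m, f@_m = (admissible alpha (cut_vector alpha m))%:R.
Proof.
elim=> {alpha f} [alpha srt _ m|alpha i j g ji lt_ij kg IH good].
  rewrite mcoeffX admissible_dominant //; congr ((_ : bool)%:R).
  have LE x : sorted_entry alpha x = nth 0%N alpha x.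
    rewrite /sorted_entry sorted_sort // => a b c ab bc; exact: leq_trans bc ab.
  apply/eqP/forallP=> [<- j|H].
    rewrite /cut_vector big1 // => x _; rewrite LE.
    by rewrite multinomE (tnth_nth 0%N) subrr.
  apply/mnmP=> x; have := cut_vectorS alpha m x.
  have /eqP/= -> := H (widen_ord (leqnSn n) x).
  have /eqP/= -> := H (Ordinal (ltn_ord x : x.+1 < n.+1)%N).
  by rewrite LE multinomE (tnth_nth 0%N); lia.
have jn := ltn_ord j; have in' := ltn_ord i.
have ij : i != j by rewrite -val_eqE /= ji; lia.
have good' := almost_dominant_swap ji lt_ij good.
have gE := IH good'; have pos' := admissible_exponent_ge0 good'.
have pos := admissible_exponent_ge0 good.
set beta := swap_entries i j alpha in gE pos' good' *.
have LE x : sorted_entry beta x = sorted_entry alpha x by exact: sorted_entry_swap.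
have cE m k : cut_vector beta m k = cut_vector alpha m k.
  by apply: eq_bigr => x _; rewrite LE.
(* The degree d is large enough for h to contain all admissible monomials, since
   these have the degree of the sorted rearrangement. *)
pose d := (\sum_(x < n) sorted_entry alpha x).+1.
pose h : {mpoly int[n]} := \sum_(m : 'X_{1..n < d})
  (admissible alpha (cut_vector alpha m))%:R *: 'X_[m].
have hE m : h@_m = (admissible alpha (cut_vector alpha m))%:R.
  have [md|dm] := ltnP (mdeg m) d.
    exact: (@mcoeff_mpoly _ _
      (fun m : 'X_{1..n} => (admissible alpha (cut_vector alpha m))%:R)).
  have -> : admissible alpha (cut_vector alpha m) = false.
    apply/negP=> /admissibleP /(_ n (leqnn n)) [] H _.
    have := cut_vector_max alpha m; rewrite H; first by rewrite /d in dm; lia.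
    by apply/negP=> /crossed_bounds; lia.
  rewrite /h raddf_sum big1 // => k _; rewrite /= mcoeffZ mcoeffX.
  case: eqP => [km|_]; last by rewrite mulr0.
  by have := bmdeg k; rewrite km; lia.
suff E : ('X_i - 'X_j) * h = 'X_i * g - 'X_j * msym (tperm i j) g.
  by move=> m; rewrite -hE; congr (_@_m); exact/esym/demazure_unique.
have -> : 'X_j * msym (tperm i j) g = msym (tperm i j) ('X_i * g).
  by rewrite msymM msym_tperm_X tpermL.
apply/mpolyP=> m; rewrite mulrBl !mcoeffB mcoeff_sym.
rewrite !(mcoeff_admissible_XM _ _ pos hE) !(mcoeff_admissible_XM _ _ pos' gE).
set T := cut_vector alpha m.
(* Away from cut j, the coordinates in all four terms are those of u; N is the
   length of the string at j. *)
pose u := set_cut (fun x => T x + ((j < x)%N : nat)%:Z) j 0.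
pose N := (sorted_entry alpha i)%:Z - (sorted_entry alpha j)%:Z + T i + T j.+1 + 1.
have hA (w : nat -> int) : (forall k, (k <= n)%N -> k != j -> w k = u k) ->
    admissible alpha w = admissible beta u && (0 <= w j <= N).
  move=> wu; rewrite (admissible_swap _ ji lt_ij good) -/beta; congr (_ && _).
    apply: eq_admissible => k kn; rewrite /set_cut; case: eqP => [->|/eqP kj].
      by rewrite /u /set_cut eqxx.
    by rewrite wu.
  have -> : w i = T i by rewrite wu /u /set_cut; [case: eqP| |]; lia.
  have -> : w j.+1 = T j.+1 + 1.
    by rewrite wu /u /set_cut ?ltnSn; [case: eqP| |]; lia.
  by rewrite /N; lia.
have gA (w1 : nat -> int) : (forall k, (k <= n)%N -> k != j -> w1 k = u k) ->
    admissible beta w1 = admissible beta u && (w1 j == 0).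
  move=> wu; have [wj|wj] := eqVneq (w1 j) 0.
    rewrite andbT; apply: eq_admissible => k kn; have [->|kj] := eqVneq k j.
      by rewrite wj /u /set_cut eqxx.
    exact: wu.
  rewrite andbF; apply/negP=> /admissibleP /(_ j (ltnW jn)) [] H _.
  by rewrite H ?eqxx // in wj; rewrite /beta uncrossed_swap.
have ij1 : (i < j)%N by rewrite ji.
have uE (k : nat) : k != j -> u k = T k + ((j < k)%N : nat)%:Z.
  by rewrite /u /set_cut => /negPf->.
have -> : admissible alpha (fun x => T x + ((i < x)%N : nat)%:Z) =
    admissible beta u && (0 <= T j + 1 <= N).
  rewrite hA => [|k kn kj]; first by rewrite ij1.
  by rewrite uE //; congr (_ + _); lia.
have -> : admissible alpha (fun x => T x + ((j < x)%N : nat)%:Z) =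
    admissible beta u && (0 <= T j <= N).
  rewrite hA => [|k kn kj]; first by rewrite ltnn addr0.
  by rewrite uE.
have -> : admissible beta (fun x => cut_vector beta m x + ((i < x)%N : nat)%:Z) =
    admissible beta u && (T j + 1 == 0).
  rewrite gA => [|k kn kj]; first by rewrite ij1 cE.
  by rewrite uE // cE; congr (_ + _); lia.
set m' := [multinom _ | _ < _].
have -> : admissible beta (fun x => cut_vector beta m' x + ((i < x)%N : nat)%:Z) =
    admissible beta u && (T i + (sorted_entry alpha i)%:Z - (m j)%:Z + 1 == 0).
  rewrite gA => [|k kn kj].
    rewrite ij1 cE cut_vector_tperm ?(ltnW jn) // /set_cut.
    by have -> : (j == j :> nat) = true by lia.
  rewrite uE // cE cut_vector_tperm // /set_cut (negPf kj).
  by congr (_ + _); lia.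
case: (boolP (admissible beta u)) => [adm|//]; rewrite !andTb.
have N0 : 0 <= N.
  have := admissible_ge0 adm (ltnW in'); have := admissible_ge0 adm jn.
  rewrite !uE; try lia.
  have := sorted_entry_anti alpha (leqnSn i); rewrite -ji.
  rewrite ltnSn /N; lia.
have -> : (T i + (sorted_entry alpha i)%:Z - (m j)%:Z + 1 == 0) = (T j == N).
  have Tj1E : T j.+1 = T j + (sorted_entry alpha j)%:Z - (m j)%:Z.
    exact: cut_vectorS.
  by rewrite /N Tj1E; clear; apply/eqP/eqP; lia.
exact: indicator_shift.
Qed.

Local Close Scope ring_scope.

(** * Shapes of the blocks *)

Lemma count_nth_iota (n : nat) (alpha : n.-tuple nat) (P : pred nat) :
  count P (sort geq alpha) = count (fun x => P (nth 0 alpha x)) (iota 0 n).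
Proof.
have -> : count P (sort geq alpha) = count P alpha.
  by apply/seq.permP; rewrite perm_sort.
by rewrite -{1}(mkseq_nth 0 alpha) /mkseq count_map size_tuple.
Qed.

Lemma sorted_entry_le (n : nat) (alpha : n.-tuple nat) (s : seq nat) (v j : nat) :
  (forall x, x < n -> v < nth 0 alpha x -> x \in s) -> size s <= j ->
  sorted_entry alpha j <= v.
Proof.
move=> sub le_j; rewrite leqNgt; apply/negP=> lt_v.
have jn : j < n.
  rewrite ltnNge; apply/negP=> nj; move: lt_v.
  by rewrite /sorted_entry nth_default // size_sort size_tuple.
have : count (ltn v) (sort geq alpha) <= size s.
  rewrite count_nth_iota -size_filter; apply: uniq_leq_size.
    by rewrite filter_uniq ?iota_uniq.
  by move=> x; rewrite mem_filter mem_iota /= => /andP[vx xn]; apply: sub.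
have : all (ltn v) (take j.+1 (sort geq alpha)).
  apply/(all_nthP 0) => i; rewrite size_take size_sort size_tuple => ij.
  have ij1 : i < j.+1 by move: ij; case: ifP; lia.
  rewrite nth_take //=; apply: leq_trans lt_v _.
  exact: sorted_entry_anti.
rewrite all_count => /eqP cE.
rewrite -[sort geq alpha](cat_take_drop j.+1) count_cat cE.
by rewrite size_take size_sort size_tuple; case: ifP; lia.
Qed.

Lemma sorted_entry_ge (n : nat) (alpha : n.-tuple nat) (s : seq nat) (v j : nat) :
  uniq s -> (forall x, x \in s -> x < n /\ v <= nth 0 alpha x) -> j < size s ->
  v <= sorted_entry alpha j.
Proof.
move=> us sub lt_j; rewrite leqNgt; apply/negP=> lt_v.
have : size s <= count (leq v) (sort geq alpha).
  rewrite count_nth_iota -size_filter; apply: uniq_leq_size => // x /sub[xn vx].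
  by rewrite mem_filter mem_iota vx.
rewrite -[sort geq alpha](cat_take_drop j) count_cat.
have -> : count (leq v) (drop j (sort geq alpha)) = 0.
  apply/eqP; rewrite -leqn0 leqNgt -has_count; apply/(has_nthP 0) => -[i _].
  rewrite nth_drop leqNgt => /negP[]; apply: leq_ltn_trans lt_v.
  by apply: sorted_entry_anti; lia.
have := count_size (leq v) (take j (sort geq alpha)).
by rewrite size_take; case: ifP; lia.
Qed.

Lemma sorted_entry_eq (n : nat) (alpha : n.-tuple nat) (s t : seq nat) (v j : nat) :
  (forall x, x < n -> v < nth 0 alpha x -> x \in s) -> uniq t ->
  (forall x, x \in t -> x < n /\ v <= nth 0 alpha x) -> size s <= j < size t ->
  sorted_entry alpha j = v.
Proof.
move=> sub ut supt /andP[le_j lt_j]; apply/eqP; rewrite eqn_leq.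
by rewrite (sorted_entry_le sub) ?(sorted_entry_ge ut).
Qed.

Definition nondecreasing_on (n : nat) (alpha : n.-tuple nat) (c e : nat) : Prop :=
  forall x y, c <= x -> x <= y -> y < e -> nth 0 alpha x <= nth 0 alpha y.

(** If the last but one entry exceeds an earlier entry, then by (0, 1, 2) the last
two entries are equal, to b say, and only one entry below b precedes them: it is
either the first entry of the block or lies to the left of the block. This small
entry travels to the left through the block, and lambda is constantly b where it
passes. *)
Lemma block_upper (n : nat) (alpha : n.-tuple nat) (c e : nat) :
  almost_dominant alpha -> c.+1 < e -> e <= n -> nondecreasing_on alpha c e ->
  smaller_before alpha e.-2 ->
  [/\ forall x, c <= x -> x.+1 < e -> sorted_entry alpha x = nth 0 alpha e.-1,
      forall j, c < j -> j < e -> crossed alpha j /\ smaller_before alpha j,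
      forall j, c < j -> j < e -> larger_after alpha j.-1 ->
        ~~ crossed alpha j.-1
    & ~~ crossed alpha c \/
      [/\ crossed alpha c, smaller_before alpha c,
          sorted_entry alpha c.-1 = nth 0 alpha e.-1
        & larger_after alpha c.-1 -> ~~ crossed alpha c.-1]].
Proof.
move=> good ce en inc /smaller_beforeP[x0 [x0e _ lt_x0]].
have no22 := almost_dominant_no22 good; case: (good) => no012 _.
have eE : e.-2.+1 = e.-1 by lia.
have b2 : nth 0 alpha e.-2 = nth 0 alpha e.-1.
  have : nth 0 alpha e.-2 <= nth 0 alpha e.-1 by apply: inc; lia.
  have [lt_b|] := ltnP (nth 0 alpha e.-2) (nth 0 alpha e.-1); last by lia.
  by case: (no012 x0 e.-2 e.-1); lia.
rewrite b2 in lt_x0; set b := nth 0 alpha e.-1 in b2 lt_x0 *.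
have le_b x : c <= x -> x < n -> nth 0 alpha x <= b.
  move=> cx xn; have [xe|ex] := ltnP x e; first by apply: inc; lia.
  rewrite leqNgt; apply/negP=> lt_b.
  by apply: (no012 x0 e.-1 x); rewrite -/b; lia.
have two_ge x y : x != y -> maxn x y < e.-2 ->
    maxn (nth 0 alpha x) (nth 0 alpha y) < b -> False.
  move=> xy xye lt_b; apply: (no22 x y e.-2 e.-1); rewrite ?b2 -/b; lia.
(* The small entry either is the first one of the block or precedes the block. *)
have [lt_c|ge_c] := ltnP (nth 0 alpha c) b.
  have c2 : c < e.-2.
    rewrite ltn_neqAle; apply/andP; split; last by lia.
    by apply/eqP=> c2; move: lt_c; rewrite c2 b2; lia.
  have in_b x : c < x -> x < e -> nth 0 alpha x = b.
    move=> cx xe; apply/eqP; rewrite eqn_leq le_b /=; try lia.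
    rewrite leqNgt; apply/negP=> lt_b; have [xe2|xe2] := ltnP x e.-2.
      by apply: (two_ge c x); lia.
    have [xE|xE] : x = e.-2 \/ x = e.-1 by lia.
      by rewrite xE b2 in lt_b; lia.
    by rewrite xE in lt_b; lia.
  have ge_b x : x < c -> b <= nth 0 alpha x.
    by move=> xc; rewrite leqNgt; apply/negP=> lt_b; apply: (two_ge x c); lia.
  have nc : ~~ crossed alpha c.
    apply/crossedP=> -[x [y [xc cy yn lt_xy]]].
    by have := ge_b x xc; have := le_b y cy yn; lia.
  split; last by left.
  - move=> x cx xe.
    apply: (@sorted_entry_eq _ _ (iota 0 c) (rem c (iota 0 e))).
    + move=> y yn lt_y; rewrite mem_iota /= add0n ltnNge; apply/negP=> cy.
      by have := le_b y cy yn; lia.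
    + by rewrite rem_uniq ?iota_uniq.
    + move=> y; rewrite mem_rem_uniq ?iota_uniq // inE mem_iota /= add0n.
      move=> /andP[yc ye]; split; first by lia.
      have [lt_yc|le_cy] := ltnP y c; first exact: ge_b.
      by rewrite in_b //; lia.
    + by rewrite size_rem ?size_iota ?mem_iota; lia.
  - move=> j cj je; split.
      by apply/crossedP; exists c, j; rewrite (in_b j) //; split=> //; lia.
    by apply/smaller_beforeP; exists c; rewrite (in_b j) //; split=> //; lia.
  - move=> j cj je /larger_afterP[y [jy yn lt_y]].
    have [->//|jc] := eqVneq j.-1 c; exfalso.
    by have := le_b y ltac:(lia) yn; have := in_b j.-1 ltac:(lia) ltac:(lia); lia.
have in_b x : c <= x -> x < e -> nth 0 alpha x = b.
  move=> cx xe; apply/eqP; rewrite eqn_leq le_b /=; try lia.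
  by apply: leq_trans ge_c _; apply: inc; lia.
have x0c : x0 < c.
  by rewrite ltnNge; apply/negP=> cx0; have := in_b x0 cx0 ltac:(lia); lia.
have ge_b x : x < c -> x != x0 -> b <= nth 0 alpha x.
  by move=> xc xx0; rewrite leqNgt; apply/negP=> lt_b; apply: (two_ge x x0); lia.
have LE x : c.-1 <= x -> x.+1 < e -> sorted_entry alpha x = b.
  move=> cx xe.
  apply: (@sorted_entry_eq _ _ (rem x0 (iota 0 c)) (rem x0 (iota 0 e))).
  - move=> y yn lt_y; rewrite mem_rem_uniq ?iota_uniq // inE mem_iota /= add0n.
    apply/andP; split; first by apply/eqP=> yx0; rewrite yx0 in lt_y; lia.
    by rewrite ltnNge; apply/negP=> cy; have := le_b y cy yn; lia.
  - by rewrite rem_uniq ?iota_uniq.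
  - move=> y; rewrite mem_rem_uniq ?iota_uniq // inE mem_iota /= add0n.
    move=> /andP[yx0 ye]; split; first by lia.
    have [lt_yc|le_cy] := ltnP y c; first exact: ge_b.
    by rewrite in_b.
  - by rewrite !size_rem ?size_iota ?mem_iota; lia.
have cr j : c <= j -> j < e -> crossed alpha j.
  by move=> cj je; apply/crossedP; exists x0, j; rewrite (in_b j) //; split=> //; lia.
have sm j : c <= j -> j < e -> smaller_before alpha j.
  by move=> cj je; apply/smaller_beforeP; exists x0; rewrite (in_b j) //; split=> //; lia.
split.
- by move=> x cx xe; apply: LE => //; lia.
- by move=> j cj je; split; [apply: cr|apply: sm]; lia.
- move=> j cj je /larger_afterP[y [jy yn lt_y]]; exfalso.
  by have := le_b y ltac:(lia) yn; have := in_b j.-1 ltac:(lia) ltac:(lia); lia.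
- right; split; [apply: cr; lia|apply: sm; lia|apply: LE; lia|].
  move=> /larger_afterP[y [cy yn lt_y]]; apply/crossedP=> -[x [z [xc cz zn lt_z]]].
  have y_b := le_b y ltac:(lia) yn.
  have x0E : c.-1 = x0.
    by apply/eqP; apply/negPn/negP=> ne; have := ge_b c.-1 ltac:(lia) ne; lia.
  have x_b : b <= nth 0 alpha x by apply: ge_b; lia.
  have [zc|zc] := ltnP z c; last by have := le_b z zc zn; lia.
  have zE : z = x0 by lia.
  by rewrite zE in lt_z; lia.
Qed.

(** Two equal entries a of the block leave room for only one larger entry to the
right. It travels through the whole block, where lambda is constantly a. *)
Lemma block_lower_const (n : nat) (alpha : n.-tuple nat) (c e : nat) :
  almost_dominant alpha -> c.+1 < e -> e <= n -> nondecreasing_on alpha c e ->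
  nth 0 alpha c = nth 0 alpha e.-1 -> larger_after alpha e.-1 ->
  [/\ forall x, c < x -> x <= e -> sorted_entry alpha x = nth 0 alpha e.-1,
      forall j, c < j -> j <= e -> crossed alpha j /\ larger_after alpha j.-1
    & forall j, c < j -> j <= e -> smaller_before alpha j ->
        ~~ crossed alpha j.+1].
Proof.
move=> good ce en inc ca /larger_afterP[y0 [ey0 y0n]].
have no22 := almost_dominant_no22 good; case: (good) => no012 _.
set a := nth 0 alpha e.-1 in ca * => lt_y0.
have in_a x : c <= x -> x < e -> nth 0 alpha x = a.
  move=> cx xe; have := inc c x (leqnn c) cx xe.
  by have := inc x e.-1 cx ltac:(lia) ltac:(lia); rewrite ca -/a; lia.
have ge_a x : x < e -> a <= nth 0 alpha x.
  move=> xe; have [xc|cx] := ltnP x c; last by rewrite in_a.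
  rewrite leqNgt; apply/negP=> lt_a.
  by apply: (no012 x e.-1 y0); rewrite -?/a; lia.
have le_a y : e <= y -> y < n -> y != y0 -> nth 0 alpha y <= a.
  move=> ey yn yy0; rewrite leqNgt; apply/negP=> lt_a.
  apply: (no22 e.-2 e.-1 y y0); try lia.
  by rewrite in_a -?/a; lia.
have y0e : e <= y0 by lia.
split.
- move=> x cx xe.
  apply: (@sorted_entry_eq _ _ (y0 :: iota 0 c) (y0 :: iota 0 e)).
  + move=> y yn lt_y; rewrite inE mem_iota /= add0n.
    case: (eqVneq y y0) => //= yy0; rewrite ltnNge; apply/negP=> cy.
    have [ye|ey] := ltnP y e; first by have := in_a y cy ye; lia.
    by have := le_a y ey yn yy0; lia.
  + by rewrite /= iota_uniq mem_iota /= add0n -leqNgt y0e.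
  + move=> y; rewrite inE mem_iota /= add0n => /orP[/eqP->|ye]; first by lia.
    by split; [lia|exact: ge_a].
  + by rewrite /= !size_iota; lia.
- move=> j cj je; split.
    by apply/crossedP; exists c, y0; split=> //; lia.
  by apply/larger_afterP; exists y0; rewrite (in_a j.-1); try split; lia.
- move=> j cj je /smaller_beforeP[z [zj jn lt_z]].
  have za : a <= nth 0 alpha z by apply: ge_a; lia.
  have [jlt|ej] := ltnP j e; first by have := in_a j ltac:(lia) jlt; lia.
  have jE : j = e by lia.
  have jy0 : j = y0.
    by apply/eqP/negPn/negP=> ne; have := le_a j ej jn ne; lia.
  apply/crossedP=> -[x [y [xj jy yn lt_xy]]].
  have y_a : nth 0 alpha y <= a by apply: le_a; lia.
  have [xe|ex] := ltnP x e; first by have := ge_a x xe; lia.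
  have xE : x = y0 by lia.
  by rewrite xE in lt_xy; lia.
Qed.

(** With nothing smaller before it and nothing larger after it, a constant block is
not touched by any operator. *)
Lemma block_lower_flat (n : nat) (alpha : n.-tuple nat) (c e : nat) :
  c.+1 < e -> e <= n -> nondecreasing_on alpha c e ->
  nth 0 alpha c = nth 0 alpha e.-1 -> ~~ larger_after alpha e.-1 ->
  ~~ smaller_before alpha e.-2 ->
  (forall x, c <= x -> x < e -> sorted_entry alpha x = nth 0 alpha e.-1) /\
  (forall j, c <= j -> j <= e -> ~~ crossed alpha j).
Proof.
move=> ce en inc ca nl ns; set a := nth 0 alpha e.-1 in ca *.
have in_a x : c <= x -> x < e -> nth 0 alpha x = a.
  move=> cx xe; have := inc c x (leqnn c) cx xe.
  by have := inc x e.-1 cx ltac:(lia) ltac:(lia); rewrite ca -/a; lia.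
have ge_a x : x < e -> a <= nth 0 alpha x.
  move=> xe; have [cx|xc] := leqP c x; first by rewrite in_a.
  rewrite leqNgt; apply/negP=> lt_a; case/negP: ns.
  by apply/smaller_beforeP; exists x; rewrite (in_a e.-2); try split; lia.
have le_a y : c <= y -> y < n -> nth 0 alpha y <= a.
  move=> cy yn; have [ye|ey] := ltnP y e; first by rewrite in_a.
  rewrite leqNgt; apply/negP=> lt_a; case/negP: nl.
  by apply/larger_afterP; exists y; split=> //; lia.
split.
- move=> x cx xe; apply: (@sorted_entry_eq _ _ (iota 0 c) (iota 0 e)).
  + move=> y yn lt_y; rewrite mem_iota /= add0n ltnNge; apply/negP=> cy.
    by have := le_a y cy yn; lia.
  + exact: iota_uniq.
  + by move=> y; rewrite mem_iota /= add0n => ye; split; [lia|exact: ge_a].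
  + by rewrite !size_iota cx.
- move=> j cj je; apply/crossedP=> -[x [y [xj jy yn lt_xy]]].
  by have := ge_a x ltac:(lia); have := le_a y ltac:(lia) yn; lia.
Qed.

(** Here the block is a, ..., a, b. If a occurs at least twice, then b is the only
entry larger than a from there on, so nothing crosses the right end of the block
and lambda is constantly a behind its first position. *)
Lemma block_lower_step (n : nat) (alpha : n.-tuple nat) (c e : nat) :
  almost_dominant alpha -> c.+1 < e -> e <= n -> nondecreasing_on alpha c e ->
  nth 0 alpha c < nth 0 alpha e.-1 -> ~~ smaller_before alpha e.-2 ->
  [/\ nth 0 alpha e.-2 < nth 0 alpha e.-1,
      forall j, c < j -> j < e -> crossed alpha j,
      forall j, c < j -> j < e ->
        [/\ larger_after alpha j.-1 & smaller_before alpha j -> j.+1 = e],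
      smaller_before alpha e.-1
    & c.+2 < e -> ~~ crossed alpha e /\
        (forall x, c < x -> x < e -> sorted_entry alpha x = nth 0 alpha c)].
Proof.
move=> good ce en inc lt_ca ns.
have no22 := almost_dominant_no22 good; case: (good) => no012 _.
set a := nth 0 alpha c in lt_ca *; set b := nth 0 alpha e.-1 in lt_ca *.
have in_a x : c <= x -> x < e.-1 -> nth 0 alpha x = a.
  move=> cx xe; have le1 := inc c x (leqnn c) cx ltac:(lia).
  have le2 := inc x e.-2 cx ltac:(lia) ltac:(lia).
  have [lt_a|] := ltnP a (nth 0 alpha e.-2); last by rewrite -/a in le1 *; lia.
  case/negP: ns; apply/smaller_beforeP; exists c; split=> //; try lia.
  have [//|] := ltnP c e.-2; move=> ec; have eE : e.-2 = c by lia.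
  by rewrite eE /a ltnn in lt_a.
have ge_a x : x < e -> a <= nth 0 alpha x.
  move=> xe; have [cx|xc] := leqP c x; first exact: inc.
  rewrite leqNgt; apply/negP=> lt_a; case/negP: ns.
  by apply/smaller_beforeP; exists x; rewrite (in_a e.-2); try split; lia.
split.
- by rewrite (in_a e.-2); lia.
- move=> j cj je; apply/crossedP; exists c, e.-1; split=> //; lia.
- move=> j cj je; split.
    by apply/larger_afterP; exists e.-1; rewrite (in_a j.-1); try split; lia.
  move=> /smaller_beforeP[z [zj _ lt_z]]; apply/eqP/negPn/negP=> ne.
  by have := in_a j ltac:(lia) ltac:(lia); have := ge_a z ltac:(lia); lia.
- by apply/smaller_beforeP; exists c; split=> //; lia.
- move=> c2; have ncr : ~~ crossed alpha e.
    apply/crossedP=> -[x [y [xe ey yn lt_xy]]].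
    have ax := ge_a x xe; apply: (no22 c c.+1 e.-1 y); try lia.
    by rewrite (in_a c.+1); rewrite -?/a -?/b; lia.
  split=> // x cx xe.
  apply: (@sorted_entry_eq _ _ (e.-1 :: iota 0 c) (iota 0 e)).
  + move=> y yn lt_y; rewrite inE mem_iota /= add0n.
    case: (eqVneq y e.-1) => //= ye; rewrite ltnNge; apply/negP=> cy.
    have [ye1|ey] := ltnP y e; first by have := in_a y cy ltac:(lia); lia.
    by case/negP: ncr; apply/crossedP; exists c, y; split=> //; lia.
  + exact: iota_uniq.
  + by move=> y; rewrite mem_iota /= add0n => ye; split; [lia|exact: ge_a].
  + by rewrite /= !size_iota; lia.
Qed.

(** * The support is a union of boxes *)

Definition is_block (n : nat) (C : pred nat) (c e : nat) : Prop :=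
  [/\ c < e, e <= n, C c, C e & forall d, c < d -> d < e -> ~~ C d].

(** On a constant block this is its entry, and on a block a, ..., a, b with at least
two entries a it is a whenever v is admissible. A block a, b may be crossed at
both ends, and then the bound varies with v e. *)
Definition lower_bound (n : nat) (alpha : n.-tuple nat) (e : nat) (v : nat -> int) :
    int :=
  if nth 0 alpha e.-2 < nth 0 alpha e.-1 then ((sorted_entry alpha e.-1)%:Z - v e)%R
  else (nth 0%N alpha e.-1)%:Z%R.

(** What the inequalities at the inner cuts of the block [c, e) amount to; a block
with one position has no inner cut. *)
Definition in_box (n : nat) (alpha : n.-tuple nat) (c e : nat) (v : nat -> int) :
    Prop :=
  c.+1 < e -> forall x, c <= x -> x < e ->
  if smaller_before alpha e.-2 then (exponent alpha v x <= (nth 0%N alpha e.-1)%:Z)%R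
  else (lower_bound alpha e v <= exponent alpha v x)%R.

Lemma exists_block (n : nat) (C : pred nat) (x : nat) :
  C 0 -> C n -> x < n -> exists c e, [/\ is_block n C c e, c <= x & x < e].
Proof.
move=> C0 Cn xn.
have exc : exists c, C c && (c <= x) by exists 0; rewrite C0.
have exe : exists e, C e && (x < e) by exists n; rewrite Cn.
have bc c : C c && (c <= x) -> c <= x by case/andP.
case: (ex_maxnP exc bc) => c /andP[Cc cx] max_c.
case: (ex_minnP exe) => e /andP[Ce xe] min_e.
exists c, e; split=> //; split=> //; first by lia.
  by apply: min_e; rewrite Cn.
move=> d cd de; apply/negP=> Cd; have [dx|xd] := leqP d x.
  by have := max_c d; rewrite Cd dx; lia.
by have := min_e d; rewrite Cd xd; lia.
Qed.

Lemma admissible_uncrossed (n : nat) (alpha : n.-tuple nat) (v : nat -> int) (j : nat) :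
  admissible alpha v -> j <= n -> ~~ crossed alpha j -> v j = 0%R.
Proof. by move=> /admissibleP H jn; case: (H j jn). Qed.

Lemma admissible_crossed (n : nat) (alpha : n.-tuple nat) (v : nat -> int) (j : nat) :
  admissible alpha v -> crossed alpha j ->
  (v j <= (sorted_entry alpha j.-1)%:Z - (sorted_entry alpha j)%:Z
          + (if larger_after alpha j.-1 then v j.-1 else 0)
          + (if smaller_before alpha j then v j.+1 else 0))%R.
Proof.
move=> /admissibleP H cj; have /andP[_ jn] := crossed_bounds cj.
by case: (H j (ltnW jn)) => _ /(_ cj)[].
Qed.

Section Blocks.

Variables (n : nat) (alpha : n.-tuple nat) (C : pred nat).
Hypothesis good : almost_dominant alpha.
Hypothesis inc : forall d, 0 < d -> d < n -> ~~ C d ->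
  nth 0 alpha d.-1 <= nth 0 alpha d.

Lemma block_nondecreasing (c e : nat) :
  is_block n C c e -> nondecreasing_on alpha c e.
Proof.
case=> _ en _ _ nC x y cx; elim: y => [|y IH] xy ye.
  by have -> : x = 0 by lia.
have [->//|xy1] := eqVneq x y.+1.
apply: leq_trans (IH _ _) _; try lia.
by apply: (inc (d := y.+1)); [lia|lia|apply: nC; lia].
Qed.

Lemma lower_bound_const (c e : nat) (v : nat -> int) :
  is_block n C c e -> c.+1 < e -> nth 0 alpha c = nth 0 alpha e.-1 ->
  lower_bound alpha e v = (nth 0%N alpha e.-1)%:Z%R.
Proof.
move=> blk ce ca; have := block_nondecreasing blk.
move=> /(_ c e.-2 (leqnn _) ltac:(lia) ltac:(lia)).
by rewrite /lower_bound ca leqNgt => /negPf->.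
Qed.

Lemma block_const_or_step (c e : nat) :
  is_block n C c e -> c.+1 < e ->
  nth 0 alpha c = nth 0 alpha e.-1 \/ nth 0 alpha c < nth 0 alpha e.-1.
Proof.
move=> blk ce; have := block_nondecreasing blk.
by move=> /(_ c e.-1 (leqnn _) ltac:(lia) ltac:(lia)); lia.
Qed.

(** At a cut through which an entry travels in one direction only, the upper bound
on v j, solved for the exponent next to the cut, compares this exponent with the
next entry of lambda, which has a constant value there. *)
Lemma admissible_in_box (c e : nat) (v : nat -> int) :
  is_block n C c e -> admissible alpha v -> in_box alpha c e v.
Proof.
move=> blk adm ce x cx xe; have ninc := block_nondecreasing blk.
have [_ en _ _ _] := blk.
have ge0 j : j <= n -> (0 <= v j)%R by move=> jn; exact: (admissible_ge0 adm jn).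
have unc j : j <= n -> ~~ crossed alpha j -> v j = 0%R.
  by move=> jn; exact: (admissible_uncrossed adm jn).
have cr := @admissible_crossed _ _ _ _ adm.
case: ifP => [sb|/negbT nsb].
  have [LE crj lac m4] := block_upper good ce en ninc sb.
  have [xc|xc] := eqVneq x c.
    rewrite xc; case: m4 => [nc|[cc sc LcE lc]].
      rewrite /exponent (unc c ltac:(lia) nc) LE //.
      by have := ge0 c.+1 ltac:(lia); lia.
    have := cr c cc; rewrite sc LcE /exponent.
    case: ifP => [/lc nc|_]; last by lia.
    by rewrite (unc c.-1 _ nc); clear -ce en; lia.
  have [crx sx] := crj x ltac:(lia) xe.
  have := cr x crx; rewrite sx LE /exponent; try lia.
  case: ifP => [lx|_]; last by clear; lia.
  have {}nc : ~~ crossed alpha x.-1 by apply: lac lx => //; clear -cx xc; lia.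
  have xn : x.-1 <= n by clear -xe en; lia.
  by rewrite (unc x.-1 xn nc); clear; lia.
have [ca|ca] := block_const_or_step blk ce.
  rewrite (lower_bound_const v blk ce ca).
  have [la|nla] := boolP (larger_after alpha e.-1).
    have [LE crj sbj] := block_lower_const good ce en ninc ca la.
    have [crx lx] := crj x.+1 ltac:(lia) xe.
    have := cr x.+1 crx; rewrite lx /= (LE x.+1) /exponent; try lia.
    case: ifP => [sx|_]; last by lia.
    have nc := sbj x.+1 ltac:(lia) xe sx.
    have /andP[_ xn] := crossed_bounds crx.
    by rewrite (unc x.+2 xn nc); clear; lia.
  have [LE nc] := block_lower_flat ce en ninc ca nla nsb.
  rewrite /exponent LE // (unc x) ?(unc x.+1) //; try (apply: nc; lia); lia.
have [lt_b crj lsj se big] := block_lower_step good ce en ninc ca nsb.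
rewrite /lower_bound lt_b.
have [xE|xE] := eqVneq x e.-1.
  have eE : e.-1.+1 = e by lia.
  by rewrite xE /exponent eE; have := ge0 e.-1 ltac:(lia); lia.
have crx := crj x.+1 ltac:(lia) ltac:(lia).
have [lx sx] := lsj x.+1 ltac:(lia) ltac:(lia).
have := cr x.+1 crx; rewrite lx /= /exponent.
have [c2|c2] := ltnP c.+2 e.
  have [nce LE] := big c2; rewrite (unc e en nce).
  rewrite (LE x.+1) ?(LE e.-1); try (clear -cx xe xE ce; lia).
  case: ifP => [/sx xe2|_]; last by clear; lia.
  by rewrite xe2 (unc e en nce); clear; lia.
have xE2 : x.+1 = e.-1 by clear -cx xe xE c2; lia.
have eE : e.-1.+1 = e by clear -ce; lia.
by rewrite xE2 se eE; clear; lia.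
Qed.

(** Since the exponents lie on one side of the constant value of lambda, v is
monotone along the block, so its sign is controlled by an end of the block. *)
Lemma box_ge0 (c e : nat) (w : nat -> int) :
  is_block n C c e -> in_box alpha c e w ->
  (0 <= w c)%R -> (0 <= w e)%R ->
  (~~ crossed alpha c -> w c = 0%R) -> (~~ crossed alpha e -> w e = 0%R) ->
  forall j, c < j -> j < e ->
  (0 <= w j)%R /\ (~~ crossed alpha j -> w j = 0%R).
Proof.
move=> blk box wc we unc une j cj je; have ninc := block_nondecreasing blk.
have [_ en _ _ _] := blk; have ce : c.+1 < e by lia.
move: (box ce); have [sb|nsb] := boolP (smaller_before alpha e.-2) => {}box.
  have [LE crj _ _] := block_upper good ce en ninc sb.
  split; last by case: (crj j cj je) => ->.
  have up k : c + k < e -> (0 <= w (c + k)%N)%R.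
    elim: k => [|k IH] ke; first by rewrite addn0.
    have := box (c + k) ltac:(lia) ltac:(lia).
    by rewrite addnS /exponent LE; lia.
  by have := up (j - c) ltac:(lia); rewrite subnKC; lia.
have [ca|ca] := block_const_or_step blk ce.
  rewrite (lower_bound_const w blk ce ca) in box.
  have [la|nla] := boolP (larger_after alpha e.-1).
    have [LE crj sbj] := block_lower_const good ce en ninc ca la.
    split; last by case: (crj j cj (ltnW je)) => ->.
    have down k : c < e - k -> (0 <= w (e - k)%N)%R.
      elim: k => [|k IH] ke; first by rewrite subn0.
      have := box (e - k.+1) ltac:(lia) ltac:(lia).
      have E : (e - k.+1).+1 = e - k by lia.
      by rewrite /exponent LE ?E; lia.
    by have := down (e - j) ltac:(lia); rewrite subKn; lia.
  have [LE nc] := block_lower_flat ce en ninc ca nla nsb.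
  have up k : c + k <= e -> (w (c + k)%N <= w c)%R.
    elim: k => [|k IH] ke; first by rewrite addn0.
    have := box (c + k) ltac:(lia) ltac:(lia).
    by rewrite addnS /exponent LE; lia.
  have down k : c <= e - k -> k <= e -> (w e <= w (e - k)%N)%R.
    elim: k => [|k IH] ke ke'; first by rewrite subn0.
    have := box (e - k.+1) ltac:(lia) ltac:(lia).
    have E : (e - k.+1).+1 = e - k by lia.
      by rewrite /exponent LE ?E; lia.
  have := up (j - c) ltac:(lia); have := down (e - j) ltac:(lia) ltac:(lia).
  rewrite subnKC ?subKn; try lia.
  by rewrite unc ?une; [clear; lia|apply: nc; clear -ce; lia|apply: nc; clear -ce; lia].
have [lt_b crj lsj se big] := block_lower_step good ce en ninc ca nsb.
rewrite /lower_bound lt_b in box.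
split; last by rewrite crj.
have last_ge0 : (0 <= w e.-1)%R.
  have := box e.-1 ltac:(lia) ltac:(lia); rewrite /exponent.
  have -> : e.-1.+1 = e by lia.
  by lia.
have [->//|jE] := eqVneq j e.-1.
have [nce LE] := big ltac:(lia).
have down k : c < e.-1 - k -> (0 <= w (e.-1 - k)%N)%R.
  elim: k => [|k IH] ke; first by rewrite subn0.
  have := box (e.-1 - k.+1) ltac:(lia) ltac:(lia).
  have E : (e.-1 - k.+1).+1 = e.-1 - k by lia.
  by rewrite /exponent (LE e.-1) ?(LE (e.-1 - k.+1)) ?(une nce) ?E; lia.
by have := down (e.-1 - j) ltac:(lia); rewrite subKn; lia.
Qed.

Hypotheses (C0 : C 0) (Cn : C n).

(** Converse of [admissible_in_box], with the values of v fixed at the cuts of C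
only: given these, the inequalities decouple into one box for each block. The
delicate cuts are those of C whose inequality involves an inner coordinate of an
adjacent block; it bounds the exponent at that end of the block and is part of
the box. *)
Lemma in_box_admissible (v w : nat -> int) :
  admissible alpha v -> (forall j, j <= n -> C j -> w j = v j) ->
  (forall c e, is_block n C c e -> in_box alpha c e w) -> admissible alpha w.
Proof.
move=> adm wv box.
have ge0 j : j <= n -> (0 <= v j)%R by move=> jn; exact: (admissible_ge0 adm jn).
have unc j : j <= n -> ~~ crossed alpha j -> v j = 0%R.
  by move=> jn; exact: (admissible_uncrossed adm jn).
have inside c e j : is_block n C c e -> c < j -> j < e ->
    (0 <= w j)%R /\ (~~ crossed alpha j -> w j = 0%R).
  move=> blk; have [ce en Cc Ce _] := blk.
  have cn : c <= n by lia.
  apply: (box_ge0 blk (box _ _ blk)); rewrite wv //.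
  - exact: ge0.
  - exact: ge0.
  - exact: unc.
  - exact: unc.
have w_all j : j <= n -> (0 <= w j)%R /\ (~~ crossed alpha j -> w j = 0%R).
  move=> jn; have [Cj|Cj] := boolP (C j).
    by rewrite wv //; split; [exact: ge0|exact: unc].
  have jn' : j < n.
    by rewrite ltn_neqAle jn andbT; apply/eqP=> jE; rewrite jE Cn in Cj.
  have [c [e [blk cj je]]] := exists_block C0 Cn jn'.
  apply: (inside c e) => //; rewrite ltn_neqAle cj andbT.
  by apply/eqP=> cE; case: blk => _ _; rewrite cE (negPf Cj).
apply/admissibleP=> j jn; have [w0 wunc] := w_all j jn.
split=> // cj; split=> //.
have /andP[j0 {}jn] := crossed_bounds cj.
have wl0 : (0 <= w j.-1)%R by apply: (w_all j.-1 _).1; clear -jn; lia.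
have wr0 := (w_all j.+1 jn).1.
have jE : j.-1.+1 = j by clear -j0; lia.
have lterm0 : (0 <= if larger_after alpha j.-1 then w j.-1 else 0)%R.
  by case: ifP.
have rterm0 : (0 <= if smaller_before alpha j then w j.+1 else 0)%R.
  by case: ifP.
move: lterm0 rterm0.
set lterm := (if larger_after _ _ then _ else _).
set rterm := (if smaller_before _ _ then _ else _) => lterm0 rterm0.
(* At an inner cut, the inequality is the bound on the exponent beside it, the
   other terms being nonnegative or covered by the bound itself. *)
have [Cj|Cj] := boolP (C j); last first.
  have [c [e [blk cj' je]]] := exists_block C0 Cn jn.
  have ninc := block_nondecreasing blk; have [_ en Cc _ _] := blk.
  have {cj'} cj' : c < j.
    by rewrite ltn_neqAle cj' andbT; apply/eqP=> cE; rewrite cE (negPf Cj) in Cc.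
  have ce : c.+1 < e by clear -cj' je; lia.
  have we : ~~ crossed alpha e -> w e = 0%R by case: (w_all e en).
  have [j1c j1e j1e' cj1] : [/\ c <= j.-1, j.-1 < e, j <= e & j.-1.+1 < e].
    by clear -cj' je; split; lia.
  move: (box _ _ blk ce); clear box w_all inside ge0 unc.
  have [sb|nsb] := boolP (smaller_before alpha e.-2) => box.
    have [LE crj _ _] := block_upper good ce en ninc sb.
    have [_ sj] := crj j cj' je; rewrite (LE j.-1) //.
    have := box j (ltnW cj') je; rewrite /exponent /rterm sj.
    by clear -lterm0; lia.
  have := box j.-1 j1c j1e.
  have [ca|ca] := block_const_or_step blk ce.
    rewrite (lower_bound_const w blk ce ca).
    have [la|nla] := boolP (larger_after alpha e.-1).
      have [LE crj sbj] := block_lower_const good ce en ninc ca la.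
      have [_ lj] := crj j cj' j1e'.
      rewrite /exponent jE (LE j) // /lterm lj.
      by clear -rterm0; lia.
    have [_ nc] := block_lower_flat ce en ninc ca nla nsb.
    by have := nc j (ltnW cj') j1e'; rewrite cj.
  have [lt_b crj lsj se big] := block_lower_step good ce en ninc ca nsb.
  have [lj _] := lsj j cj' je.
  rewrite /lower_bound lt_b /lterm lj /exponent jE.
  have [c2|c2] := ltnP c.+2 e.
    have [nce LE] := big c2; rewrite (LE j) // (LE e.-1) ?(we nce).
    - by clear -rterm0; lia.
    - by clear -c2; lia.
    - by clear -c2; lia.
  have jE2 : j = e.-1 by clear -c2 cj' je; lia.
  have eE : e.-1.+1 = e by clear -ce; lia.
  by rewrite /rterm jE2 se eE; clear; lia.
have [c [e [blk cj' je]]] := exists_block C0 Cn jn.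
have cE : c = j.
  apply/eqP; rewrite eqn_leq cj' leqNgt; apply/negP=> lt_cj.
  by case: blk => _ _ _ _ /(_ j lt_cj je); rewrite Cj.
subst c; have [_ en _ Ce _] := blk; have ninc := block_nondecreasing blk.
(* An inner coordinate of the block on the right enters only if its first entry
   exceeds an earlier one; then the block is bounded above. *)
have [/andP[sj je2]|nright] := boolP (smaller_before alpha j && (j.+1 < e)).
  have sb : smaller_before alpha e.-2.
    case/smaller_beforeP: sj => z [zj _ lt_z].
    have [je2' ze en2] : [/\ j <= e.-2, z < e.-2 & e.-2 < n].
      by clear -zj je2 en; split; lia.
    have le2 : nth 0 alpha j <= nth 0 alpha e.-2.
      by apply: ninc => //; clear -je2; lia.
    by apply/smaller_beforeP; exists z; split=> //; apply: leq_trans lt_z le2.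
  have [_ _ _ [|[_ _ LE _]]] := block_upper good je2 en ninc sb; first by rewrite cj.
  have := box _ _ blk je2 j (leqnn j) je.
  by rewrite sb /rterm sj LE /exponent; clear -lterm0; lia.
have j1n : j.-1 < n by clear -jn; lia.
have [c [f [lblk cj1 fj]]] := exists_block C0 Cn j1n.
have fE : f = j.
  have jf : j <= f by clear -fj; lia.
  apply/eqP; rewrite eqn_leq jf andbT leqNgt; apply/negP=> lt_jf.
  have c_j : c < j by clear -cj1 j0; lia.
  by case: lblk => _ _ _ _ /(_ j c_j lt_jf); rewrite Cj.
subst f; have [_ _ Cc _ _] := lblk; have lninc := block_nondecreasing lblk.
(* Likewise, an inner coordinate of the block on the left enters only if this
   block is constant and precedes a larger entry; then it is bounded below. *)
have [/andP[lj cj2]|nleft] := boolP (larger_after alpha j.-1 && (c.+1 < j)).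
  case: (good) => no012 _; case/larger_afterP: (lj) => y [jy yn lt_y].
  have [cj2' j2j1 j2y] : [/\ c <= j.-2, j.-2 <= j.-1 & j.-2 < y].
    by clear -cj2 jy; split; lia.
  have le2 := lninc j.-2 j.-1 cj2' j2j1 fj.
  have nsb : ~~ smaller_before alpha j.-2.
    apply/smaller_beforeP=> -[z [zj _ lt_z]].
    apply: (no012 z j.-2 y zj j2y yn lt_z).
    exact: leq_ltn_trans le2 lt_y.
  have ca : nth 0 alpha c = nth 0 alpha j.-1.
    have [//|lt_c] := block_const_or_step lblk cj2.
    have c_j1 : c < j.-1 by clear -cj2; lia.
    by case: (no012 c j.-1 y c_j1 jy yn lt_c lt_y).
  have [LE _ _] := block_lower_const good cj2 (ltnW jn) lninc ca lj.
  have := box _ _ lblk cj2 j.-1 cj1 fj.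
  rewrite (negPf nsb) (lower_bound_const w lblk cj2 ca) /lterm lj /exponent jE.
  rewrite (LE j) //; first by clear -rterm0; lia.
  by clear -cj2; lia.
(* In all other cases, only coordinates at cuts of C are involved. *)
have -> : lterm = if larger_after alpha j.-1 then v j.-1 else 0%R.
  rewrite /lterm; case: ifP nleft => //= _ cj2; rewrite wv //.
    by clear -jn; lia.
  by have -> : j.-1 = c by clear -cj2 cj1 j0; lia.
have -> : rterm = if smaller_before alpha j then v j.+1 else 0%R.
  rewrite /rterm; case: ifP nright => //= _ je2; rewrite wv //.
  by have -> : j.+1 = e by clear -je2 je; lia.
by rewrite wv ?(ltnW jn) //; apply: (admissible_crossed adm).
Qed.

End Blocks.

Lemma block_unique (n : nat) (C : pred nat) (c e c' e' x : nat) :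
  is_block n C c e -> is_block n C c' e' -> c <= x < e -> c' <= x < e' ->
  c = c' /\ e = e'.
Proof.
move=> [ce en Cc Ce nC] [ce' en' Cc' Ce' nC'] /andP[cx xe] /andP[cx' xe'].
split; apply/eqP; rewrite eqn_leq; apply/andP; split; rewrite leqNgt;
  apply/negP=> lt.
- by have := nC' c lt ltac:(lia); rewrite Cc.
- by have := nC c' lt ltac:(lia); rewrite Cc'.
- by have := nC e' ltac:(lia) lt; rewrite Ce'.
- by have := nC' e ltac:(lia) lt; rewrite Ce.
Qed.

Lemma sum_exponent (n : nat) (alpha : n.-tuple nat) (v : nat -> int) (c e : nat) :
  c <= e -> (\sum_(c <= x < e) exponent alpha v x =
    (\sum_(c <= x < e) sorted_entry alpha x)%N%:Z + v c - v e)%R.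
Proof.
move=> ce; rewrite -(subnKC ce); elim: (e - c) => [|d IH].
  by rewrite addn0 !big_geq // add0r subrr.
by rewrite addnS !big_nat_recr ?leq_addr //= IH PoszD /exponent; lia.
Qed.

(** So (b, ..., b, rest) is a partition if the rest is what remains of the degree
of the block: moving the monomial inside its box to these exponents keeps it
admissible, so the rest is nonnegative. *)
Lemma upper_block_sum_ge (n : nat) (alpha : n.-tuple nat) (C : pred nat)
    (c e : nat) (v : nat -> int) :
  almost_dominant alpha -> C 0 -> C n ->
  (forall d, 0 < d -> d < n -> ~~ C d -> nth 0 alpha d.-1 <= nth 0 alpha d) ->
  is_block n C c e -> c.+1 < e -> smaller_before alpha e.-2 ->
  admissible alpha v ->
  (((e - c).-1 * nth 0 alpha e.-1)%N%:Z <= \sum_(c <= x < e) exponent alpha v x)%R.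
Proof.
move=> good C0 Cn inc blk ce sb adm; have [_ en Cc Ce nC] := blk.
have ninc := block_nondecreasing inc blk.
have [LE _ _ _] := block_upper good ce en ninc sb.
set b := nth 0 alpha e.-1 in LE *.
have ee : e = e.-1.+1 by lia.
have sumL : \sum_(c <= x < e) sorted_entry alpha x =
    (e - c).-1 * b + sorted_entry alpha e.-1.
  rewrite {1}ee big_nat_recr /=; last by lia.
  congr (_ + _); rewrite (eq_big_nat _ _ (F2 := fun=> b)) => [|x /andP[cx xe]].
    by rewrite sum_nat_const_nat; congr (_ * _); lia.
  by apply: LE; lia.
have sumE := sum_exponent alpha v (ltnW (ltnW ce)).
rewrite sumL PoszD in sumE.
(* The corner of the box with exponents b, ..., b and the rest at the end. *)
pose w j := if c < j < e then v c else v j.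
suff : (0 <= exponent alpha w e.-1)%R.
  rewrite /exponent -ee /w ltnn andbF; have -> : (c < e.-1 < e) by lia.
  by rewrite sumE; lia.
apply: (admissible_exponent_ge0 good); last by lia.
apply: (in_box_admissible good inc C0 Cn adm) => [j jn Cj|c' e' blk'].
  by rewrite /w; case: ifP => // /andP[cj je]; have := nC j cj je; rewrite Cj.
have bnd := admissible_in_box good inc blk adm.
have := admissible_in_box good inc blk' adm.
move=> bnd' ce' x cx' xe'; have := bnd' ce' x cx' xe'.
have [/andP[cx xe]|out] := boolP (c <= x < e).
  have x_in : c <= x < e by rewrite cx.
  have x_in' : c' <= x < e' by rewrite cx'.
  have [cE eE] := block_unique blk blk' x_in x_in'; subst c' e'; rewrite sb -/b => _.
  rewrite /exponent /w.
  have [xE|xE] := eqVneq x e.-1.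
    have -> : (c < x < e) by lia.
    have -> : (c < x.+1 < e) = false by lia.
    rewrite xE -ee.
    have up : (\sum_(c <= x < e) exponent alpha v x <= ((e - c) * b)%N%:Z)%R.
      rewrite -sum_nat_const_nat -sum_Posz; apply: ler_sum_nat => y /andP[cy ye].
      by have := bnd ce y cy ye; rewrite sb.
    have mE : (e - c) * b = (e - c).-1 * b + b.
      by rewrite -{1}(prednK (_ : 0 < e - c)) ?mulSn 1?addnC //; lia.
    by move: up; rewrite sumE mE PoszD; lia.
  have -> : (c < x.+1 < e) by lia.
  have -> : (if c < x < e then v c else v x) = v c.
    by case: ifP => // /negbT nx; congr v; lia.
  by rewrite LE; lia.
have wx j : x <= j <= x.+1 -> w j = v j.
  by move=> jx; rewrite /w; case: ifP => // lt_j; case/negP: out; lia.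
have we : w e' = v e'.
  rewrite /w; case: ifP => // /andP[ce1 ee1]; case: blk' => _ _ _ Ce' _.
  by have := nC e' ce1 ee1; rewrite Ce'.
by rewrite /lower_bound we /exponent !wx //; lia.
Qed.

(** * Schur polynomials and Gelfand-Tsetlin patterns *)

(** Access by two natural numbers avoids the dependent type of cells. *)
Definition entry_at (n : nat) (mu : seq nat) (T : {ffun cell mu -> 'I_n})
    (r q : nat) : nat :=
  if (insub r : option 'I_(size mu)) is Some r' then
    if (insub q : option 'I_(nth 0 mu r')) is Some q' then
      T (Tagged (fun r : 'I_(size mu) => 'I_(nth 0 mu r)) q')
    else 0
  else 0.

Lemma entry_at_cell (n : nat) (mu : seq nat) (T : {ffun cell mu -> 'I_n})
    (b : cell mu) : entry_at T (tag b) (tagged b) = T b.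
Proof. by case: b => r q; rewrite /entry_at /= !valK. Qed.

Lemma cellP (mu : seq nat) (r q : nat) : r < size mu -> q < nth 0 mu r ->
  exists b : cell mu, [/\ tag b = r :> nat, tagged b = q :> nat &
    forall n (T : {ffun cell mu -> 'I_n}), T b = entry_at T r q :> nat].
Proof.
move=> lt_r lt_q.
exists (Tagged (fun r : 'I_(size mu) => 'I_(nth 0 mu r))
  (Ordinal lt_q : 'I_(nth 0 mu (Ordinal lt_r)))).
by split=> // n T; rewrite -entry_at_cell.
Qed.

Lemma sum_cells (n : nat) (mu : seq nat) (T : {ffun cell mu -> 'I_n})
    (F : nat -> nat) :
  \sum_(b : cell mu) F (T b) =
  \sum_(r < size mu) \sum_(q < nth 0 mu r) F (entry_at T r q).
Proof.
rewrite (@sig_big_dep _ _ _ _ _ xpredT (fun _ => xpredT)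
  (fun (r : 'I_(size mu)) (q : 'I_(nth 0 mu r)) => F (entry_at T r q))) /=.
by apply: eq_bigr => b _; rewrite entry_at_cell.
Qed.

(** Comparing consecutive rows suffices, because the shape is a partition. *)
Lemma semistandardP (n : nat) (mu : seq nat) (T : {ffun cell mu -> 'I_n}) :
  sorted geq mu ->
  reflect
    ((forall r q q', r < size mu -> q <= q' -> q' < nth 0 mu r ->
        entry_at T r q <= entry_at T r q') /\
     (forall r q, r.+1 < size mu -> q < nth 0 mu r.+1 ->
        entry_at T r q < entry_at T r.+1 q))
    (semistandard T).
Proof.
move=> srt.
have mu_anti r : r.+1 < size mu -> nth 0 mu r.+1 <= nth 0 mu r.
  by move=> lt_r; have /(sortedP 0) := srt; apply.
apply: (iffP forallP) => [H|[rows cols] b].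
  split=> [r q q' lt_r qq' lt_q|r q lt_r lt_q].
    have [->//|ne] := eqVneq q q'.
    have [b [br bq Tb]] := cellP lt_r (leq_ltn_trans qq' lt_q).
    have [b' [br' bq' Tb']] := cellP lt_r lt_q.
    have /forallP/(_ b')/andP[/implyP] := H b.
    rewrite Tb Tb' bq bq' => + _.
    by apply; rewrite -val_eqE /= br br' eqxx ltn_neqAle ne.
  have lt_q' : q < nth 0 mu r by apply: leq_trans lt_q (mu_anti _ lt_r).
  have [b [br bq Tb]] := cellP (ltnW lt_r) lt_q'.
  have [b' [br' bq' Tb']] := cellP lt_r lt_q.
  have /forallP/(_ b')/andP[_ /implyP] := H b.
  by rewrite Tb Tb' bq bq' br br' ltnSn eqxx; apply.
apply/forallP=> b'; rewrite -(entry_at_cell T b) -(entry_at_cell T b').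
have lt_q := ltn_ord (tagged b); have lt_r := ltn_ord (tag b).
have lt_q' := ltn_ord (tagged b'); have lt_r' := ltn_ord (tag b').
rewrite -val_eqE /=; move: lt_q lt_q'.
move: (nat_of_ord (tagged b)) (nat_of_ord (tagged b')) => q q'.
move: (nat_of_ord (tag b)) (nat_of_ord (tag b')) lt_r lt_r' => r r' lt_r lt_r'.
move=> {b b'} lt_q lt_q'; apply/andP; split; apply/implyP=> /andP[].
  by move=> /eqP ->; move=> /ltnW qq'; apply: rows.
have cols' r1 k q1 : r1 + k.+1 < size mu -> q1 < nth 0 mu (r1 + k.+1) ->
    entry_at T r1 q1 < entry_at T (r1 + k.+1) q1.
  elim: k => [|k IH]; first by rewrite addn1; apply: cols.
  rewrite addnS => lt_r1 lt_q1; apply: ltn_trans (cols _ _ lt_r1 lt_q1).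
  by apply: IH; [exact: ltnW|apply: leq_trans lt_q1 (mu_anti _ lt_r1)].
move=> rr' /eqP ->; have E : r' = r + (r' - r).-1.+1 by lia.
by rewrite E; apply: cols'; rewrite -E.
Qed.

(** Gelfand-Tsetlin patterns, encoded by N r x = number of entries below x in
row r; the variables are those with index in [c, e). *)
Record gt_pattern (mu : seq nat) (c e : nat) (M : nat -> nat) (N : nat -> nat -> nat) :
    Prop := GTPattern {
  gt_mono : forall r x y, r < size mu -> x <= y -> N r x <= N r y;
  gt_le : forall r x, r < size mu -> N r x <= nth 0 mu r;
  gt_start : forall r x, r < size mu -> x <= c -> N r x = 0;
  gt_end : forall r, r < size mu -> N r e = nth 0 mu r;
  gt_interlace : forall r x, r.+1 < size mu -> N r.+1 x.+1 <= N r x;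
  gt_weight : forall x, \sum_(r < size mu) N r x = M x }.

Definition count_below (n : nat) (mu : seq nat) (T : {ffun cell mu -> 'I_n})
    (r x : nat) : nat := \sum_(q < nth 0 mu r) (entry_at T r q < x).

Definition partial_degree (n : nat) (m : 'X_{1..n}) (x : nat) : nat :=
  \sum_(y < n | y < x) m y.

Lemma partial_degreeS (n : nat) (m : 'X_{1..n}) (x : 'I_n) :
  partial_degree m x.+1 = partial_degree m x + m x.
Proof.
rewrite /partial_degree (bigD1 x) //= addnC; congr (_ + _).
by apply: eq_bigl => y; rewrite ltnS ltn_neqAle andbC -val_eqE.
Qed.

Definition content (n : nat) (mu : seq nat) (T : {ffun cell mu -> 'I_n}) :
    'X_{1..n} := (\sum_(b : cell mu) U_(T b))%MM.

(** A decreasing predicate on [0, k) is a threshold, located by its count. *)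
Lemma sum_initial_segment (k : nat) (P : pred nat) :
  (forall q q', q <= q' -> q' < k -> P q' -> P q) ->
  forall q, q < k -> P q = (q < \sum_(i < k) P i).
Proof.
elim: k => // k IH down q; rewrite ltnS big_ord_recr /= => qk.
have {}IH := IH (fun q q' qq' lt_q => down q q' qq' (ltnW lt_q)).
have [Pk|nPk] := boolP (P k).
  have PT i : i <= k -> P i by move=> ik; apply: down Pk.
  rewrite PT // (eq_bigr (fun=> 1)) => [|i _]; last by rewrite PT // ltnW.
  by rewrite sum_nat_const card_ord; lia.
rewrite addn0; have [->|qk'] := eqVneq q k; last by apply: IH; lia.
rewrite (negPf nPk); apply/esym/negbTE; rewrite -leqNgt.
rewrite -[X in _ <= X]card_ord -sum1_card; apply: leq_sum => i _.
by case: (P i).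
Qed.

Lemma sum_ltn_ord (k a : nat) : \sum_(q < k) (q < a) = minn a k.
Proof.
elim: k => [|k IH]; first by rewrite big_ord0 minn0.
by rewrite big_ord_recr /= IH; case: (ltnP k a) => ?; lia.
Qed.

Section Tableaux.

Variables (n : nat) (mu : seq nat) (c e : nat) (B : {set 'I_n}).
Hypotheses (srt : sorted geq mu) (en : e <= n).
Hypothesis BE : forall x : 'I_n, (x \in B) = (c <= x < e).

Lemma entry_below (T : {ffun cell mu -> 'I_n}) (r q x : nat) :
  semistandard T -> r < size mu -> q < nth 0 mu r ->
  (entry_at T r q < x) = (q < count_below T r x).
Proof.
move=> /(semistandardP _ srt)[rows _] lt_r.
apply: (sum_initial_segment (P := fun q => entry_at T r q < x)) => q1 q2 q12 lt_q.
by apply: leq_ltn_trans; apply: rows.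
Qed.

Lemma partial_degree_content (T : {ffun cell mu -> 'I_n}) (x : nat) :
  partial_degree (content T) x = \sum_(r < size mu) count_below T r x.
Proof.
rewrite -(sum_cells T (fun y => y < x)) /partial_degree /content.
rewrite (eq_bigr (fun y : 'I_n => \sum_(b : cell mu) U_(T b)%MM y)); last first.
  by move=> y _; rewrite /content mnm_sumE.
rewrite exchange_big /=; apply: eq_bigr => b _.
rewrite (bigID (fun y => y == T b)) /= [X in _ + X]big1 ?addn0 => [|y /andP[_ ne]].
  have [lt_x|ge_x] := ltnP (T b) x.
    rewrite (big_pred1 (T b)) => [|y]; first by rewrite mnm1E eqxx.
    by rewrite /= andbC; case: eqP => // ->.
  by rewrite big_pred0 // => y; apply/andP=> -[lt_y /eqP E]; rewrite E ltnNge ge_x in lt_y.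
by rewrite mnm1E eq_sym (negPf ne).
Qed.

Lemma partial_degree_inj (m m' : 'X_{1..n}) :
  (forall x, partial_degree m x = partial_degree m' x) -> m = m'.
Proof.
move=> E; apply/mnmP=> x; have := E x.+1; rewrite !partial_degreeS E.
exact: addnI.
Qed.

(** Strictness of the columns is the interlacing condition: entry q of row r.+1 is
below x.+1 only if the entry above it is below x. *)
Lemma gt_pattern_of_tableau (T : {ffun cell mu -> 'I_n}) (m : 'X_{1..n}) :
  semistandard T -> [forall b, T b \in B] -> content T = m ->
  gt_pattern mu c e (partial_degree m) (count_below T).
Proof.
move=> ss /forallP inB <-; have [rows cols] := elimT (semistandardP T srt) ss.
have ent r q : r < size mu -> q < nth 0 mu r -> c <= entry_at T r q < e.
  move=> lt_r lt_q; have [b [_ _ <-]] := cellP lt_r lt_q.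
  by rewrite -BE.
split.
- move=> r x y lt_r xy; apply: leq_sum => q _.
  by case: ltnP => // lt_x; rewrite (leq_trans lt_x xy).
- move=> r x lt_r; rewrite -[X in _ <= X]card_ord -sum1_card; apply: leq_sum => q _.
  by case: ltnP.
- move=> r x lt_r xc; apply: big1 => q _; have /andP[cq _] := ent r q lt_r (ltn_ord q).
  by rewrite ltnNge (leq_trans xc cq).
- move=> r lt_r; rewrite -[RHS]card_ord -sum1_card; apply: eq_bigr => q _.
  by have /andP[_ ->] := ent r q lt_r (ltn_ord q).
- move=> r x lt_r; rewrite leqNgt; apply/negP; set k := count_below T r x => lt_k.
  have k_mu : k < nth 0 mu r.+1.
    apply: leq_trans lt_k _; rewrite -[X in _ <= X]card_ord -sum1_card.
    by apply: leq_sum => q _; case: ltnP.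
  have mu_r : nth 0 mu r.+1 <= nth 0 mu r by have /(sortedP 0) := srt; apply.
  have := entry_below x.+1 ss lt_r k_mu; rewrite lt_k.
  have := entry_below x ss (ltnW lt_r) (leq_trans k_mu mu_r); rewrite -/k ltnn.
  by have := cols r k lt_r k_mu; lia.
- by move=> x; rewrite partial_degree_content.
Qed.

(** Entry q of row r is the number of y with N r y.+1 <= q, so that it is below x
exactly if q < N r x. *)
Lemma tableau_of_gt_pattern (m : 'X_{1..n}) (N : nat -> nat -> nat) :
  gt_pattern mu c e (partial_degree m) N ->
  exists T : {ffun cell mu -> 'I_n},
    [/\ semistandard T, [forall b, T b \in B] & content T = m].
Proof.
case=> mono le_mu start end_ inter weight.
pose val_at r q := \sum_(y < n) (N r y.+1 <= q).
have below r q x : r < size mu -> q < nth 0 mu r -> x <= n ->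
    (val_at r q < x) = (q < N r x).
  move=> lt_r lt_q xn; case: x xn => [|x] xn.
    by rewrite (start r 0 lt_r) // ltn0 ltn0.
  have := @sum_initial_segment n (fun y => N r y.+1 <= q) _ x xn.
  rewrite -/(val_at r q) => H; rewrite ltnS leqNgt -H.
    by rewrite -ltnNge.
  by move=> q1 q2 q12 _ /=; apply: leq_trans; apply: mono.
have inv r q : r < size mu -> q < nth 0 mu r -> c <= val_at r q < e.
  move=> lt_r lt_q; rewrite (below r q e) // end_ // lt_q andbT.
  have [cn|nc] := leqP c n.
    by rewrite leqNgt (below r q c) // (start r c).
  by have := end_ r lt_r; rewrite (start r e lt_r); lia.
have val_n (b : cell mu) : val_at (tag b) (tagged b) < n.
  by have := inv _ _ (ltn_ord (tag b)) (ltn_ord (tagged b)); lia.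
pose T : {ffun cell mu -> 'I_n} := [ffun b => Ordinal (val_n b)].
have TE r q : r < size mu -> q < nth 0 mu r -> entry_at T r q = val_at r q.
  by move=> lt_r lt_q; have [b [<- <- <-]] := cellP lt_r lt_q; rewrite ffunE.
have mu_anti r : r.+1 < size mu -> nth 0 mu r.+1 <= nth 0 mu r.
  by move=> lt_r; have /(sortedP 0) := srt; apply.
exists T; split.
- apply/(semistandardP _ srt); split=> [r q q' lt_r qq' lt_q|r q lt_r lt_q].
    rewrite !TE ?(leq_ltn_trans qq') //; apply: leq_sum => y _.
    by case le_q: (N r y.+1 <= q) => //; rewrite (leq_trans le_q qq').
  have lt_q' := leq_trans lt_q (mu_anti r lt_r).
  rewrite !TE ?(ltnW lt_r) //; set v := val_at r q.
  have vn : v < n by have := inv r q (ltnW lt_r) lt_q'; lia.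
  rewrite ltnNge -ltnS; apply/negP; rewrite below // => lt_N.
  have : q < N r v by apply: leq_trans lt_N (inter _ _ lt_r).
  by rewrite -below ?(ltnW lt_r) ?(ltnW vn) // ltnn.
- apply/forallP=> b; rewrite ffunE BE /=.
  by apply: inv; apply: ltn_ord.
apply: partial_degree_inj => x.
have [xn|nx] := leqP x n; last first.
  have trunc (m1 : 'X_{1..n}) : partial_degree m1 x = partial_degree m1 n.
    by apply: eq_bigl => y; rewrite ltn_ord (ltn_trans (ltn_ord y) nx).
  rewrite (trunc m) (trunc (content T)) partial_degree_content -weight; apply: eq_bigr => r _.
  rewrite /count_below (eq_bigr (fun q : 'I__ => (q < N r n) : nat)) => [|q _].
    by rewrite sum_ltn_ord (minn_idPl _) // le_mu.
  by rewrite TE // below.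
rewrite partial_degree_content -weight; apply: eq_bigr => r _.
rewrite /count_below (eq_bigr (fun q : 'I__ => (q < N r x) : nat)) => [|q _].
  by rewrite sum_ltn_ord (minn_idPl _) // le_mu.
by rewrite TE // below.
Qed.

Lemma tableau_inj (T T' : {ffun cell mu -> 'I_n}) :
  semistandard T -> semistandard T' ->
  (forall r x, r < size mu -> count_below T r x = count_below T' r x) -> T = T'.
Proof.
move=> ss ss' E; apply/ffunP=> b; apply: val_inj => /=.
rewrite -!entry_at_cell; set r := tag b; set q := tagged b.
have lt_r := ltn_ord r; have lt_q := ltn_ord q.
have H x := entry_below x ss lt_r lt_q; have H' x := entry_below x ss' lt_r lt_q.
apply/eqP; rewrite eqn_leq; apply/andP; split.
  by rewrite -ltnS H E // -H'.
by rewrite -ltnS H' -E // -H.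
Qed.

Lemma mcoeff_schur (m : 'X_{1..n}) :
  ((schur B mu)@_m = \sum_(T : {ffun cell mu -> 'I_n} |
    semistandard T && [forall b, T b \in B]) (content T == m)%:R)%R.
Proof.
rewrite /schur raddf_sum; apply: eq_bigr => T _ /=.
by rewrite -mcoeffX /content -mprodXE.
Qed.

Lemma mcoeff_schur_unique_gt (m : 'X_{1..n}) (N : nat -> nat -> nat) :
  gt_pattern mu c e (partial_degree m) N ->
  (forall N', gt_pattern mu c e (partial_degree m) N' ->
    forall r x, r < size mu -> N' r x = N r x) ->
  ((schur B mu)@_m = 1)%R.
Proof.
move=> gtN uniqN; have [T [ss inB cT]] := tableau_of_gt_pattern gtN.
rewrite mcoeff_schur (bigD1 T) /=; last by rewrite ss.
rewrite cT eqxx big1 ?addr0 // => T' /andP[/andP[ss' inB'] ne].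
case: eqP => // cT'; case/eqP: ne.
apply: tableau_inj => // r x lt_r.
rewrite (uniqN _ (gt_pattern_of_tableau ss inB cT)) //.
by rewrite (uniqN _ (gt_pattern_of_tableau ss' inB' cT')).
Qed.

Lemma mcoeff_schur_no_gt (m : 'X_{1..n}) :
  (forall N, ~ gt_pattern mu c e (partial_degree m) N) ->
  ((schur B mu)@_m = 0)%R.
Proof.
move=> noN; rewrite mcoeff_schur big1 // => T /andP[ss inB].
case: eqP => // cT; case: (noN (count_below T)).
exact: gt_pattern_of_tableau.
Qed.

End Tableaux.

(** * Schur polynomials of almost rectangular shapes *)

(** In p variables these shapes, rectangles up to one row, have all Kostka numbers
equal to 0 or 1. *)
Definition box_shape (up : bool) (p k s : nat) : seq nat :=
  mkseq (fun r => if r == (if up then p.-1 else 0) then s - p.-1 * k else k) p.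

(** The condition under which [box_shape] is a partition of s into p parts. *)
Definition box_size_ok (up : bool) (p k s : nat) : bool :=
  if up then p.-1 * k <= s <= p * k else (p * k <= s) && ((p == 0) ==> (s == 0)).

Definition box_support (n : nat) (up : bool) (c e k s : nat) (m : 'X_{1..n}) : bool :=
  [forall x : 'I_n,
    if c <= x < e then (if up then m x <= k else k <= m x) else m x == 0] &&
  (\sum_(x < n | c <= x < e) m x == s).

Lemma box_shape_sorted (up : bool) (p k s : nat) :
  box_size_ok up p k s -> sorted geq (box_shape up p k s).
Proof.
move=> ok; apply/(sortedP 0) => r; rewrite size_mkseq => rp.
rewrite /box_shape !nth_mkseq ?(ltnW rp) //.
have pE : p * k = p.-1 * k + k by case: p rp {ok} => // p _; rewrite mulSn addnC.
move: ok; rewrite /box_size_ok pE; move: (p.-1 * k) => W.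
rewrite /geq; case: up => /=; last by case: (eqVneq r 0); lia.
by case: (eqVneq r.+1 p.-1); case: (eqVneq r p.-1); lia.
Qed.

Lemma partial_degree_sum (n : nat) (m : 'X_{1..n}) (c e : nat) :
  c <= e -> partial_degree m e =
  partial_degree m c + \sum_(x < n | c <= x < e) m x.
Proof.
move=> ce; rewrite /partial_degree (bigID (fun x : 'I_n => x < c)) /=.
congr addn; last by apply: eq_bigl => x; rewrite -leqNgt andbC.
by apply: eq_bigl => x; case: (ltnP x c) => xc; rewrite ?andbF // andbT; lia.
Qed.

(** The total of the forced rows of a pattern, j being the free row. *)
Lemma sum_const_but_one (p a j k : nat) : j < p -> j < a -> a <= p ->
  \sum_(r < p | r != j :> nat) (if r < a then k else 0) = a.-1 * k.
Proof.
move=> jp ja ap; have := sum_ltn_ord p a; rewrite (minn_idPl ap).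
rewrite (bigD1 (Ordinal jp)) //= ja => E.
have {}E : \sum_(r < p | r != j :> nat) (r < a) = a.-1.
  transitivity (\sum_(i < p | i != Ordinal jp) (i < a)); last first.
    by rewrite -[in RHS](E : 1 + _ = a).
  by apply: eq_bigl => r; rewrite -val_eqE.
rewrite -E big_distrl /=; apply: eq_bigr => r _.
by case: (r < a); rewrite ?mul1n ?mul0n.
Qed.

Section BoxSchur.

Variables (n : nat) (up : bool) (c e k s : nat) (m : 'X_{1..n}).
Hypotheses (ce : c <= e) (en : e <= n).
Let p := e - c.
Let mu := box_shape up p k s.
Hypothesis ok : box_size_ok up p k s.

Let size_mu : size mu = p. Proof. exact: size_mkseq. Qed.

Let special q := if up then q.-1 else 0.

Let muE r : r < p -> nth 0 mu r = if r == special p then s - p.-1 * k else k.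
Proof. by move=> rp; rewrite /mu /box_shape nth_mkseq. Qed.

(** At c + q, row [special q] receives what the weight leaves to it, and the other
rows are forced. *)
Definition box_gt (r y : nat) : nat :=
  let q := minn (y - c) p in
  if q == 0 then 0
  else if r == special q then partial_degree m (c + q) - q.-1 * k
  else if r < q then k else 0.

Lemma gt_interlace_iter (N : nat -> nat -> nat) (d r x : nat) :
  gt_pattern mu c e (partial_degree m) N -> r + d < p -> N (r + d) (x + d) <= N r x.
Proof.
move=> gt; elim: d => [|d IH] rd; first by rewrite !addn0.
rewrite !addnS; apply: leq_trans (IH _); last by lia.
by apply: (gt_interlace gt); rewrite size_mu; lia.
Qed.

(** Follow the diagonal of N r (c + q). If r >= q, it starts with the value 0 at c.
Otherwise it ends at e with the length of row r + (p - q), which is k, as is the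
length of row r; only the free row escapes this. *)
Lemma gt_forced (N : nat -> nat -> nat) (r q : nat) :
  gt_pattern mu c e (partial_degree m) N -> r < p -> 0 < q <= p ->
  r != special q -> N r (c + q) = if r < q then k else 0.
Proof.
move=> gt rp /andP[q0 qp] ne; case: (ltnP r q) => rq.
  have r_ne : r != special p by move: ne; rewrite /special; case: up; lia.
  have rd_ne : r + (p - q) != special p.
    by move: ne; rewrite /special; case: up; lia.
  apply/eqP; rewrite eqn_leq; apply/andP; split.
    by have := gt_le gt (c + q) (_ : r < size mu); rewrite muE // (negPf r_ne) size_mu; apply.
  have := gt_interlace_iter (d := p - q) (r := r) (c + q) gt ltac:(lia).
  have -> : c + q + (p - q) = e by rewrite /p in qp *; lia.
  by rewrite (gt_end gt) ?size_mu ?muE ?(negPf rd_ne) //; lia.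
have := gt_interlace_iter (d := q) (r := r - q) c gt ltac:(lia).
rewrite subnK // (gt_start gt (_ : r - q < size mu) (leqnn c)); first by lia.
by rewrite size_mu; lia.
Qed.

Lemma gt_partial_degree (N : nat -> nat -> nat) (q : nat) :
  gt_pattern mu c e (partial_degree m) N -> 0 < q <= p ->
  partial_degree m (c + q) = N (special q) (c + q) + q.-1 * k.
Proof.
move=> gt q_in; have /andP[q0 qp] := q_in; rewrite -(gt_weight gt).
have jq : special q < q by rewrite /special; case: up; lia.
have jp : special q < size mu by rewrite size_mu; lia.
rewrite (bigD1 (Ordinal jp)) //=; congr (_ + _).
rewrite -(@sum_const_but_one (size mu) q (special q)) ?size_mu //; try lia.
by apply: eq_bigr => r /= ne; apply: gt_forced => //; rewrite -size_mu.
Qed.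

Lemma gt_pattern_eq_box (N : nat -> nat -> nat) :
  gt_pattern mu c e (partial_degree m) N ->
  forall r y, r < size mu -> N r y = box_gt r y.
Proof.
move=> gt r y lt_r; rewrite /box_gt /=.
have rp : r < p by rewrite -size_mu.
case: eqP => [q0|/eqP q0]; first by apply: (gt_start gt lt_r); lia.
set q := minn (y - c) p in q0 *.
have q_in : 0 < q <= p by rewrite /q in q0 *; lia.
have -> : N r y = N r (c + q).
  have [ye|ey] := leqP y e; first by congr (N r _); rewrite /q /p; lia.
  have -> : c + q = e by rewrite /q /p; lia.
  apply/eqP; rewrite eqn_leq (gt_mono gt lt_r (ltnW ey)) andbT.
  by rewrite (gt_end gt lt_r) (gt_le gt).
have [->|ne] := eqVneq r (special q); last exact: gt_forced.
by rewrite (gt_partial_degree gt q_in) addnK.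
Qed.

(** The exponent of a variable is k plus the difference between two consecutive
free rows. In the lower shape the free row is always row 0, which grows; in the
upper shape it moves down by one row, and interlacing makes it shrink. *)
Lemma gt_box_support (N : nat -> nat -> nat) :
  gt_pattern mu c e (partial_degree m) N -> box_support up c e k s m.
Proof.
move=> gt.
have pd0 y : y <= c -> partial_degree m y = 0.
  move=> yc; rewrite -(gt_weight gt); apply: big1 => r _.
  exact: (gt_start gt (ltn_ord r) yc).
have pde y : e <= y -> partial_degree m y = partial_degree m e.
  move=> ey; rewrite -!(gt_weight gt); apply: eq_bigr => r _.
  have lt_r := ltn_ord r; apply/eqP; rewrite eqn_leq (gt_mono gt lt_r ey) andbT.
  by rewrite (gt_end gt lt_r) (gt_le gt).
have p_end : 0 < p -> partial_degree m e = s.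
  move=> p0; have := gt_partial_degree gt (_ : 0 < p <= p); rewrite p0 leqnn => /(_ isT).
  have -> : c + p = e by rewrite /p; lia.
  have jp : special p < p by rewrite /special; case: up; lia.
  rewrite (gt_end gt) ?size_mu // muE // eqxx => ->.
  move: ok; rewrite /box_size_ok; case: up; first by lia.
  by case/andP=> [pk _]; rewrite subnK //; apply: leq_trans pk; rewrite leq_mul2r leq_pred orbT.
apply/andP; split; last first.
  have := partial_degree_sum m ce; rewrite (pd0 c) // add0n => <-.
  have [p0|] := posnP p; last by move=> /p_end ->.
  have ec : e = c by rewrite /p in p0; lia.
  move: ok; rewrite ec (pd0 c) // /box_size_ok p0; case: up.
    by rewrite mul0n => /andP[_]; rewrite leqn0 eq_sym.
  by case/andP=> _; rewrite eqxx eq_sym.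
apply/forallP=> x; have := partial_degreeS m x.
case: ifP => [/andP[cx xe]|/negbT out]; last first.
  have [xc|cx] := ltnP x c; first by rewrite !pd0 //; lia.
  by rewrite !(pde x) ?(pde x.+1); lia.
have xE : x.+1 = c + (x - c).+1 :> nat by lia.
have q_in : 0 < (x - c).+1 <= p by rewrite /p; lia.
rewrite xE (gt_partial_degree gt q_in) /=.
have [xc|xc] := eqVneq (x : nat) c.
  rewrite xc subnn mul0n addn0 (pd0 c) // add0n => mE.
  have j0 : special 1 = 0 by rewrite /special; case: up.
  rewrite j0 in mE; have p0 : 0 < p by rewrite /p; lia.
  have [p1|p1] := eqVneq p 1.
    have E : c + 1 = e by rewrite /p in p1; lia.
    rewrite E (gt_end gt) ?size_mu // muE // {1}p1 j0 eqxx {1}p1 mul0n subn0 in mE.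
    by move: ok; rewrite -mE /box_size_ok p1 !mul1n !mul0n; case: up; lia.
  have := gt_le gt (c + 1) (_ : 0 < size mu).
  have := gt_interlace_iter (d := p.-1) (r := 0) (c + 1) gt ltac:(lia).
  have -> : c + 1 + p.-1 = e by rewrite /p in p0 *; lia.
  have p1p : p.-1 < p by lia.
  rewrite add0n (gt_end gt) ?size_mu ?muE //.
  rewrite mE /special; case: up => [_|].
    have -> : (0 == p.-1) = false by lia.
    by apply.
  by have -> : (p.-1 == 0) = false by lia.
have q_in' : 0 < x - c <= p by rewrite /p; lia.
have xE' : x = c + (x - c) :> nat by lia.
have := gt_partial_degree gt q_in'; rewrite -xE' => ->.
have qk : (x - c) * k = (x - c).-1 * k + k.
  by case: (x - c) q_in' => // q _; rewrite mulSn addnC.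
rewrite qk -xE => mE.
have lt0 : 0 < size mu by rewrite size_mu /p; lia.
move: mE; rewrite /special; case: (up) => /= mE.
  have := gt_interlace gt x (_ : (x - c).-1.+1 < size mu).
  have -> : (x - c).-1.+1 = x - c by lia.
  by rewrite size_mu => /(_ ltac:(rewrite /p; lia)); lia.
by have := gt_mono gt lt0 (leqnSn x); lia.
Qed.

Lemma box_support_gt :
  box_support up c e k s m -> gt_pattern mu c e (partial_degree m) box_gt.
Proof.
move=> /andP[/forallP mE /eqP sE].
have pdS x : x < n -> exists2 d, partial_degree m x.+1 = partial_degree m x + d &
    (if c <= x < e then (if up then d <= k else k <= d) else d == 0) : bool.
  by move=> xn; exists (m (Ordinal xn)); [exact: (partial_degreeS m (Ordinal xn))|
    exact: (mE (Ordinal xn))].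
have pd0 y : y <= c -> partial_degree m y = 0.
  elim: y => [|y IH] yc; first by rewrite /partial_degree big_pred0.
  have [d -> ] := pdS y ltac:(lia); rewrite IH; last by lia.
  by case: ifP; lia.
have pdn y : partial_degree m (n + y) = partial_degree m n.
  by apply: eq_bigl => x; rewrite ltn_ord ltn_addr.
have pde : partial_degree m e = s.
  by rewrite (partial_degree_sum m ce) pd0 ?sE.
have pd_ed d : e + d <= n -> partial_degree m (e + d) = s.
  elim: d => [|d IH] dn; first by rewrite addn0.
  have [d' E] := pdS (e + d) ltac:(lia); rewrite addnS E IH; last by lia.
  by case: ifP; lia.
have pd_ge y : e <= y -> partial_degree m y = s.
  move=> ey; have [yn|ny] := leqP y n.
    by rewrite -[y](subnKC ey) pd_ed // subnKC.
  have -> : partial_degree m y = partial_degree m n.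
    by rewrite -[y](subnKC (ltnW ny)) pdn.
  by have := pd_ed (n - e); rewrite subnKC // => ->.
pose P q := partial_degree m (c + q).
have P0 : P 0 = 0 by rewrite /P addn0 pd0.
have Pp : P p = s by rewrite /P /p subnKC.
have PS q : q < p -> if up then P q.+1 <= P q + k else P q + k <= P q.+1.
  move=> qp; have cqn : c + q < n by move: qp; rewrite /p; lia.
  have [d E] := pdS _ cqn; rewrite /P addnS E.
  have -> : c <= c + q < e by move: qp; rewrite /p; lia.
  by case: up; rewrite leq_add2l.
have Pk q : q <= p -> if up then P q <= q * k else q * k <= P q.
  elim: q => [|q IH] qp; first by rewrite P0 mul0n; case: up.
  have := PS q qp; have := IH (ltnW qp); rewrite mulSn.
  by move: (q * k) => W; case: up; lia.
have Psk d : d <= p -> if up then s <= P (p - d) + d * k else P (p - d) + d * k <= s.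
  elim: d => [|d IH] dp; first by rewrite subn0 Pp mul0n addn0; case: up.
  have := PS (p - d.+1) ltac:(lia); have := IH (ltnW dp).
  have -> : (p - d.+1).+1 = p - d by lia.
  by rewrite mulSn; move: (d * k) => W; case: up; lia.
have kS q : 0 < q -> q * k = q.-1 * k + k by case: q => // q _; rewrite mulSn addnC.
have Pk1 q : 0 < q <= p -> q.-1 * k <= P q.
  move=> /andP[q0 qp]; have := Pk q qp; rewrite kS //.
  have := Psk (p - q) (leq_subr _ _); rewrite subKn //.
  move: ok; rewrite /box_size_ok; case: up; last by lia.
  have -> : p.-1 * k = (p - q) * k + q.-1 * k by rewrite -mulnDl; congr (_ * _); lia.
  by move: ((p - q) * k) (q.-1 * k) (p * k) => W W' W''; lia.
pose V r q := if q == 0 then 0 else if r == special q then P q - q.-1 * k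
  else if r < q then k else 0.
have boxE r y : box_gt r y = V r (minn (y - c) p) by [].
have V_step r q : q < p -> V r q <= V r q.+1.
  move=> qp; rewrite /V /special; case: (posnP q) => [->//|q0].
  rewrite /= (kS q q0); have := PS q qp; have := Pk q (ltnW qp); rewrite kS //.
  move: (q.-1 * k) => W; case: up.
    by case: (eqVneq r q.-1); case: (eqVneq r q); case: (ltnP r q); case: (ltnP r q.+1); lia.
  by case: (eqVneq r 0); case: (ltnP r q); case: (ltnP r q.+1); lia.
have V_mono r q q' : q <= q' -> q' <= p -> V r q <= V r q'.
  elim: q' => [|q' IH] qq' qp; first by have -> : q = 0 by lia.
  have [->//|ne] := eqVneq q q'.+1.
  by apply: leq_trans (V_step r q' qp); apply: IH; lia.
have V_end r : r < p -> V r p = nth 0 mu r.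
  move=> rp; rewrite muE // /V; have -> : (p == 0) = false by lia.
  by rewrite rp Pp.
have V_inter r q : q < p -> V r.+1 q.+1 <= V r q.
  move=> qp; rewrite /V /special; case: (posnP q) => [->|q0].
    by case: up.
  rewrite /= (kS q q0); have := PS q qp; have := Pk q (ltnW qp); rewrite kS //.
  move: (q.-1 * k) => W; case: up.
    by case: (eqVneq r.+1 q); case: (eqVneq r q.-1); case: (ltnP r q);
      case: (ltnP r.+1 q.+1); lia.
  by case: (eqVneq r 0); case: (ltnP r q); case: (ltnP r.+1 q.+1) => /=; lia.
split; rewrite ?size_mu.
- by move=> r x y rp xy; rewrite !boxE; apply: V_mono; lia.
- by move=> r x rp; rewrite boxE -V_end //; apply: V_mono; lia.
- by move=> r x rp xc; rewrite boxE /V; have -> : minn (x - c) p = 0 by lia.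
- by move=> r rp; rewrite boxE -/p minnn V_end.
- move=> r x rp; rewrite !boxE; have [xe|ex] := ltnP x e.
    have [xc|cx] := ltnP x c.
      by have -> : minn (x.+1 - c) p = 0 by lia.
    have -> : minn (x.+1 - c) p = (x - c).+1 by rewrite /p; lia.
    have -> : minn (x - c) p = x - c by rewrite /p; lia.
    by apply: V_inter; rewrite /p; lia.
  have -> : minn (x.+1 - c) p = p by rewrite /p; lia.
  have -> : minn (x - c) p = p by rewrite /p; lia.
  rewrite !V_end ?(ltnW rp) //.
  have /(sortedP 0) := box_shape_sorted ok; rewrite -/mu size_mu; exact.
- move=> y; set q := minn (y - c) p.
  rewrite (eq_bigr (fun r : 'I_p => V r q)) => [|r _]; last by rewrite boxE.
  have pdq : partial_degree m y = P q.
    have [ye|ey] := leqP y e; last first.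
      by rewrite (pd_ge y (ltnW ey)) -Pp; congr P; rewrite /q /p; lia.
    have [yc|cy] := leqP y c.
      by rewrite pd0 //; have -> : q = 0 by rewrite /q; lia.
    by rewrite /P; congr partial_degree; rewrite /q /p; lia.
  have [q0|q0] := posnP q.
    by rewrite pdq q0 P0 big1 // => r _; rewrite /V.
  have qp : q <= p by rewrite /q; lia.
  have jp : special q < p by rewrite /special; case: up; lia.
  have jq : special q < q by rewrite /special; case: up; lia.
  rewrite (bigD1 (Ordinal jp)) //= {1}/V; have -> : (q == 0) = false by lia.
  rewrite eqxx pdq.
  have -> : \sum_(r < p | r != Ordinal jp) V r q = q.-1 * k.
    rewrite -(sum_const_but_one k jp jq qp); apply: eq_big => r.
      by rewrite -val_eqE.
    rewrite -val_eqE /= => ne; rewrite /V (negPf ne).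
    by have -> : (q == 0) = false by lia.
  by rewrite subnK // Pk1 // q0.
Qed.

Lemma mcoeff_schur_box (B : {set 'I_n}) :
  (forall x : 'I_n, (x \in B) = (c <= x < e)) ->
  ((schur B mu)@_m = (box_support up c e k s m)%:R)%R.
Proof.
move=> BE; have srt := box_shape_sorted ok.
have [supp|nsupp] := boolP (box_support up c e k s m).
  by apply: (mcoeff_schur_unique_gt srt en BE (box_support_gt supp)) => N;
    apply: gt_pattern_eq_box.
apply: (mcoeff_schur_no_gt srt en BE) => N /gt_box_support.
by rewrite (negPf nsupp).
Qed.

End BoxSchur.

(** * Products over disjoint sets of variables *)

Definition restrict (n : nat) (B : {set 'I_n}) (m : 'X_{1..n}) : 'X_{1..n} :=
  [multinom (if x \in B then m x else 0) | x < n].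

Lemma mdeg_le (n : nat) (m m' : 'X_{1..n}) :
  (forall x, m x <= m' x) -> mdeg m <= mdeg m'.
Proof. by move=> le_m; rewrite !mdegE; apply: leq_sum => x _. Qed.

(** A monomial has only one factorization into a monomial in the variables of A
and one in those of B. *)
Lemma mcoeffM_disjoint (n : nat) (A B : {set 'I_n}) (P Q : 'X_{1..n} -> bool)
    (p q : {mpoly int[n]}) (m : 'X_{1..n}) :
  (forall x, x \in A -> x \notin B) ->
  (forall k, P k -> forall x, x \notin A -> k x = 0) ->
  (forall k, Q k -> forall x, x \notin B -> k x = 0) ->
  (forall k, p@_k = (P k)%:R)%R -> (forall k, q@_k = (Q k)%:R)%R ->
  ((p * q)@_m = [&& P (restrict A m), Q (restrict B m) &
    [forall x, (x \notin A :|: B) ==> (m x == 0)]]%:R)%R.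
Proof.
move=> dAB suppP suppQ pE qE; rewrite mcoeffM.
under eq_bigr => k _ do rewrite pE qE -natrM mulnb.
have pair_eq (k : 'X_{1..n} * 'X_{1..n}) : m = (k.1 + k.2)%MM -> P k.1 -> Q k.2 ->
    [/\ k.1 = restrict A m, k.2 = restrict B m &
        forall x, x \notin A :|: B -> m x = 0].
  move=> -> /suppP s1 /suppQ s2; split.
  - apply/mnmP=> x; rewrite mnmE mnmDE; case: ifP => [xA|/negbT /s1 //].
    by rewrite (s2 x) ?addn0 // dAB.
  - apply/mnmP=> x; rewrite mnmE mnmDE; case: ifP => [xB|/negbT /s2 //].
    rewrite (s1 x) // ; by apply/negP=> /dAB; rewrite xB.
  - by move=> x; rewrite inE negb_or mnmDE => /andP[/s1-> /s2->].
case: (boolP [&& _, _ & _]) => [/and3P[PA QB /forallP supp]|none]; last first.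
  apply: big1 => k /eqP mE; case: (boolP (P k.1 && Q k.2)) => // /andP[Pk Qk].
  have [k1 k2 supp] := pair_eq (k.1 : 'X_{1..n}, k.2 : 'X_{1..n}) mE Pk Qk.
  case/negP: none; rewrite -k1 -k2 Pk Qk /=.
  by apply/forallP=> x; apply/implyP=> /supp->.
have bA : mdeg (restrict A m) < (mdeg m).+1.
  by rewrite ltnS; apply: mdeg_le => x; rewrite mnmE; case: ifP.
have bB : mdeg (restrict B m) < (mdeg m).+1.
  by rewrite ltnS; apply: mdeg_le => x; rewrite mnmE; case: ifP.
rewrite (bigD1 (BMultinom bA, BMultinom bB)) /=; last first.
  apply/eqP/mnmP=> x; rewrite mnmDE !mnmE.
  have /implyP := supp x; rewrite inE negb_or.
  case: (boolP (x \in A)) => [/dAB/negPf->|_]; first by rewrite addn0.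
  by case: (x \in B) => //= /(_ isT)/eqP.
rewrite PA QB /= big1 ?addr0 // => k /andP[/eqP mE ne].
case: (boolP (P k.1 && Q k.2)) => // /andP[Pk Qk]; case/eqP: ne.
have [k1 k2 _] := pair_eq (k.1 : 'X_{1..n}, k.2 : 'X_{1..n}) mE Pk Qk.
by case: k k1 k2 {mE Pk Qk} => k1 k2 /= E1 E2; congr pair; apply: val_inj.
Qed.

Lemma restrict_sub (n : nat) (A B : {set 'I_n}) (m : 'X_{1..n}) :
  {subset A <= B} -> restrict A (restrict B m) = restrict A m.
Proof.
move=> AB; apply/mnmP=> x; rewrite !mnmE.
by case: ifP => // /AB ->.
Qed.

Lemma mcoeff_prod_disjoint (n : nat) (I : eqType) (r : seq I)
    (B : I -> {set 'I_n}) (P : I -> 'X_{1..n} -> bool) (F : I -> {mpoly int[n]})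
    (m : 'X_{1..n}) :
  uniq r ->
  (forall i j x, i \in r -> j \in r -> x \in B i -> x \in B j -> i = j) ->
  (forall i k, P i k -> forall x, x \notin B i -> k x = 0) ->
  (forall i k, (F i)@_k = (P i k)%:R)%R ->
  ((\prod_(i <- r) F i)@_m = (all (fun i => P i (restrict (B i) m)) r &&
    [forall x, ~~ has (fun i => x \in B i) r ==> (m x == 0)])%:R)%R.
Proof.
move=> ur disj suppP FE; elim: r ur disj m => [_ _|i r IH /= /andP[ir ur] disj] m.
  rewrite big_nil mcoeff1 /=; congr ((_ : bool)%:R)%R.
  apply/eqP/forallP=> [-> x|H]; first by rewrite mnm0E eqxx.
  by apply/mnmP=> x; have := H x; rewrite mnm0E => /eqP.
have {}IH := IH ur (fun j l x jr lr => disj j l x (mem_behead (s := i :: r) jr)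
  (mem_behead (s := i :: r) lr)).
rewrite big_cons; set U := [set x | has (fun j => x \in B j) r].
rewrite (@mcoeffM_disjoint _ (B i) U (P i)
  (fun m => all (fun j => P j (restrict (B j) m)) r &&
    [forall x, ~~ has (fun j => x \in B j) r ==> (m x == 0)])) //; first last.
- move=> k /andP[_ /forallP H] x; rewrite inE => xB.
  by apply/eqP; have /implyP := H x; apply.
- exact: suppP.
- move=> x xi; rewrite inE; apply/hasP=> -[j jr xj].
  have ij : i = j by apply: disj xi xj; rewrite ?mem_head // inE jr orbT.
  by rewrite ij jr in ir.
rewrite /= -!andbA; congr ((_ : bool)%:R)%R; congr andb.
have -> : all (fun j => P j (restrict (B j) (restrict U m))) r =
    all (fun j => P j (restrict (B j) m)) r.
  apply: eq_in_all => j jr; rewrite restrict_sub // => x xj.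
  by rewrite inE; apply/hasP; exists j.
congr andb; rewrite andb_idl => [|_].
  by apply: eq_forallb => x; rewrite !inE.
by apply/forallP=> x; apply/implyP=> xB; rewrite mnmE inE (negPf xB).
Qed.

(** * Blocks cut out by D *)

Section Cuts.

Variables (n : nat) (D : {set 'I_n}).

Definition cut_at (i : nat) : nat := nth 0 (cuts D) i.

Lemma size_cuts : size (cuts D) = #|D|.+2.
Proof. by rewrite /cuts /= size_rcons size_map -cardE. Qed.

Lemma cuts_sorted : sorted leq (cuts D).
Proof.
rewrite /cuts /= rcons_path.
have srt : sorted ltn [seq val d | d <- enum D].
  apply: (subseq_sorted ltn_trans) (iota_ltn_sorted 0 n).
  rewrite -val_enum_ord; apply: map_subseq.
  suff -> : enum D = [seq d <- enum 'I_n | d \in D] by apply: filter_subseq.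
  by rewrite /enum_mem -filter_predI; apply: eq_filter => d; rewrite /= andbT.
have le_n : all (fun d => d <= n) [seq val d | d <- enum D].
  by apply/allP=> _ /mapP[d _ ->]; apply: ltnW (ltn_ord d).
apply/andP; split.
  case: [seq val d | d <- enum D] srt {le_n} => //= d s srt.
  by apply: (sub_path _ srt) => a b; apply: ltnW.
by have := mem_last 0 [seq val d | d <- enum D]; rewrite inE => /orP[/eqP->|/(allP le_n)].
Qed.

Lemma cut_at_mono (i j : nat) : i <= j -> j < #|D|.+2 -> cut_at i <= cut_at j.
Proof.
move=> ij jD; apply: (sorted_leq_nth leq_trans leqnn 0 cuts_sorted) => //.
- by rewrite inE size_cuts; lia.
- by rewrite inE size_cuts.
Qed.

Lemma cut_at0 : cut_at 0 = 0. Proof. by []. Qed.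

Lemma cut_at_last : cut_at #|D|.+1 = n.
Proof. by rewrite /cut_at /cuts /= nth_rcons size_map -cardE ltnn eqxx. Qed.

Lemma cut_at_le (i : nat) : i < #|D|.+2 -> cut_at i <= n.
Proof. by move=> iD; rewrite -cut_at_last; apply: cut_at_mono. Qed.

Lemma mem_cuts (d : nat) : d \in cuts D -> exists2 i, i < #|D|.+2 & d = cut_at i.
Proof.
by move=> dC; exists (index d (cuts D)); rewrite -?size_cuts ?index_mem // /cut_at nth_index.
Qed.

Lemma cut_at_mem (i : nat) : i < #|D|.+2 -> cut_at i \in cuts D.
Proof. by move=> iD; rewrite mem_nth // size_cuts. Qed.

Lemma notin_cuts (d : 'I_n) : (d : nat) \notin cuts D -> d \notin D.
Proof.
apply: contra => dD; rewrite inE mem_rcons inE; apply/orP; right; apply/orP; right.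
by apply: map_f; rewrite mem_enum.
Qed.

Lemma block_interval (i : 'I_#|D|.+1) (x : 'I_n) :
  (x \in block i) = (cut_at i <= x < cut_at i.+1).
Proof. by rewrite inE. Qed.

Lemma block_is_block (i : 'I_#|D|.+1) : cut_at i < cut_at i.+1 ->
  is_block n (mem (cuts D)) (cut_at i) (cut_at i.+1).
Proof.
move=> lt_i; have iD := ltn_ord i; split=> //.
- exact: cut_at_le.
- by apply: cut_at_mem; lia.
- exact: cut_at_mem.
move=> d id di; apply/negP=> /mem_cuts[j jD dE].
have [ji|ij] := leqP j i.
  by have := cut_at_mono ji (ltnW iD : i < _.+2); lia.
by have := cut_at_mono ij jD; lia.
Qed.

Lemma exists_block_index (x : 'I_n) : exists i : 'I_#|D|.+1, x \in block i.
Proof.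
have ex : exists i, (i <= #|D|) && (cut_at i <= x) by exists 0.
have bd i : (i <= #|D|) && (cut_at i <= x) -> i <= #|D| by case/andP.
case: (ex_maxnP ex bd) => i /andP[iD ix] max_i.
exists (Ordinal (iD : i < #|D|.+1)); rewrite block_interval /= ix ltnNge.
apply/negP=> xi; have [lt_i|ge_i] := ltnP i #|D|.
  by have := max_i i.+1; rewrite lt_i xi ltnn => /(_ isT).
have iE : i = #|D| by lia.
by move: xi; rewrite iE cut_at_last leqNgt ltn_ord.
Qed.

Lemma block_index_unique (i j : 'I_#|D|.+1) (x : 'I_n) :
  x \in block i -> x \in block j -> i = j.
Proof.
rewrite !block_interval => /andP[ix xi] /andP[jx xj]; apply: val_inj => /=.
have [iD jD] := (ltn_ord i, ltn_ord j).
have [ij|ji|//] := ltngtP i j.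
  by have := cut_at_mono ij (ltnW jD : j < _.+2); lia.
by have := cut_at_mono ji (ltnW iD : i < _.+2); lia.
Qed.

Lemma card_block (i : 'I_#|D|.+1) : #|block i| = cut_at i.+1 - cut_at i.
Proof.
have iD := ltn_ord i; have le_i := cut_at_mono (leqnSn i) (iD : i.+1 < _.+2).
have len := cut_at_le (iD : i.+1 < _.+2).
rewrite -sum1_card; transitivity (\sum_(cut_at i <= x < cut_at i.+1) 1); last first.
  by rewrite sum_nat_const_nat muln1.
rewrite (big_nat_widen _ _ n) // (big_nat_widenl _ 0) // big_mkord.
by apply: eq_bigl => x; rewrite block_interval andbC.
Qed.

Lemma sum_block (i : 'I_#|D|.+1) (R : nmodType) (F : nat -> R) :
  (\sum_(x in block i) F x = \sum_(cut_at i <= x < cut_at i.+1) F x)%R.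
Proof.
have iD := ltn_ord i; have le_i := cut_at_mono (leqnSn i) (iD : i.+1 < _.+2).
have len := cut_at_le (iD : i.+1 < _.+2).
rewrite (big_nat_widen _ _ n) // (big_nat_widenl _ 0) // big_mkord.
by apply: eq_bigl => x; rewrite block_interval andbC.
Qed.

End Cuts.

(** * The D-Schur expansion *)

Lemma box_support_restrict (n : nat) (up : bool) (c e k s : nat) (B : {set 'I_n})
    (m : 'X_{1..n}) : (forall x : 'I_n, (x \in B) = (c <= x < e)) ->
  reflect ((forall x, x \in B -> if up then m x <= k else k <= m x) /\
      \sum_(x in B) m x = s)
    (box_support up c e k s (restrict B m)).
Proof.
move=> BE; have sumE : \sum_(x < n | c <= x < e) restrict B m x = \sum_(x in B) m x.
  by apply: eq_big => [x|x]; rewrite -BE // mnmE => ->.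
apply: (iffP andP); rewrite sumE => -[bnd /eqP sE]; split=> //.
- by move=> x xB; have /forallP/(_ x) := bnd; rewrite -BE xB mnmE xB.
- apply/forallP=> x; rewrite -BE mnmE.
  by case: (boolP (x \in B)) => // xB; apply: bnd.
Qed.

(** Exponents are natural numbers, so bounding one below by an integer or by its
truncation is the same. *)
Definition nat_part (z : int) : nat := if z is Posz a then a else 0.

Lemma nat_part_le (z : int) (a : nat) : (nat_part z <= a) = (z <= a%:Z)%R.
Proof. by case: z => z. Qed.

Section Expansion.

Variables (n : nat) (D : {set 'I_n}) (alpha : n.-tuple nat).
Hypotheses (good : almost_dominant alpha) (alphaD : in_Comp D alpha).

Definition block_up (i : 'I_#|D|.+1) : bool :=
  ((cut_at D i).+1 < cut_at D i.+1) && smaller_before alpha (cut_at D i.+1).-2.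

Definition block_bound (m : 'X_{1..n}) (i : 'I_#|D|.+1) : nat :=
  if block_up i then nth 0%N alpha (cut_at D i.+1).-1
  else if (cut_at D i).+1 < cut_at D i.+1 then
    nat_part (lower_bound alpha (cut_at D i.+1) (cut_vector alpha m))
  else 0.

Definition block_degree (m : 'X_{1..n}) (i : 'I_#|D|.+1) : nat :=
  \sum_(x in block i) m x.

(** The index of the D-Schur polynomial that contains the monomial m. *)
Definition box_weight (m : 'X_{1..n}) : #|D|.+1.-tuple (seq nat) :=
  [tuple box_shape (block_up i) (cut_at D i.+1 - cut_at D i)
    (block_bound m i) (block_degree m i) | i < #|D|.+1].

Definition in_support (m : 'X_{1..n}) : bool := admissible alpha (cut_vector alpha m).

(** Membership of m' in the product of boxes determined by m. *)
Definition same_box (m m' : 'X_{1..n}) : bool :=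
  [forall i : 'I_#|D|.+1, box_support (block_up i) (cut_at D i) (cut_at D i.+1)
    (block_bound m i) (block_degree m i) (restrict (block i) m')].

Lemma same_boxP (m m' : 'X_{1..n}) :
  reflect (forall i : 'I_#|D|.+1,
    (forall x, x \in block i ->
      if block_up i then m' x <= block_bound m i else block_bound m i <= m' x) /\
    block_degree m' i = block_degree m i) (same_box m m').
Proof.
apply: (iffP forallP) => H i; have := H i.
  by move=> /(box_support_restrict _ _ _ _ (block_interval i)).
by move=> Hi; apply/(box_support_restrict _ _ _ _ (block_interval i)).
Qed.

Lemma noncut_ascent (d : nat) : 0 < d -> d < n -> ~~ mem (cuts D) d ->
  nth 0 alpha d.-1 <= nth 0 alpha d.
Proof.
move=> d0 dn dC; rewrite leqNgt; apply/negP=> lt_d.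
have := alphaD (d := Ordinal dn) d0 lt_d.
by apply/negP; apply: (notin_cuts (d := Ordinal dn)).
Qed.

Lemma cut_vector_block (m : 'X_{1..n}) (i : 'I_#|D|.+1) :
  (cut_vector alpha m (cut_at D i.+1) = cut_vector alpha m (cut_at D i) +
    (\sum_(x in block i) sorted_entry alpha x)%N%:Z - (block_degree m i)%:Z)%R.
Proof.
have le_i := cut_at_mono (leqnSn i) (ltn_ord i : i.+1 < #|D|.+2).
rewrite /block_degree -!sum_Posz -addrA -sumrB /cut_vector.
rewrite (bigID (fun x : 'I_n => x < cut_at D i)) /=; congr (_ + _)%R.
  by apply: eq_bigl => x; apply: andb_idl => xi; apply: leq_trans le_i.
by apply: eq_bigl => x; rewrite block_interval -leqNgt andbC.
Qed.

(** The coordinates at the cuts of D are the partial sums of the block degrees, up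
to sign and a constant vector. *)
Lemma eq_cut_vector_cuts (m m' : 'X_{1..n}) :
  (forall i : 'I_#|D|.+1, block_degree m' i = block_degree m i) ->
  forall j, j \in cuts D -> cut_vector alpha m' j = cut_vector alpha m j.
Proof.
move=> dE j /mem_cuts[i iD ->]; elim: i iD => [|i IH] iD.
  by rewrite cut_at0 !cut_vector0.
have /= E m1 := cut_vector_block m1 (Ordinal (iD : i < #|D|.+1)).
by rewrite !E dE IH // ltnW.
Qed.

Lemma eq_block_bound (m m' : 'X_{1..n}) :
  (forall i : 'I_#|D|.+1, block_degree m' i = block_degree m i) ->
  forall i, block_bound m' i = block_bound m i.
Proof.
move=> dE i; rewrite /block_bound /lower_bound.
by rewrite (eq_cut_vector_cuts dE (cut_at_mem (ltn_ord i : i.+1 < #|D|.+2))).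
Qed.

Lemma same_box_weight (m m' : 'X_{1..n}) :
  same_box m m' -> box_weight m' = box_weight m.
Proof.
move=> /same_boxP H; have dE i : block_degree m' i = block_degree m i.
  by case: (H i).
by apply: eq_from_tnth => i; rewrite !tnth_mktuple dE (eq_block_bound dE).
Qed.

Lemma in_support_bounds (m : 'X_{1..n}) (i : 'I_#|D|.+1) (x : 'I_n) :
  in_support m -> x \in block i ->
  if block_up i then m x <= block_bound m i else block_bound m i <= m x.
Proof.
move=> adm xi; have := xi; rewrite block_interval => /andP[cx xe].
have blk := block_is_block (leq_ltn_trans cx xe).
have := admissible_in_box good noncut_ascent blk adm.
rewrite /block_bound /block_up /in_box; case: ltnP => [ce|_] //=.
move=> /(_ isT x cx xe); rewrite cut_vector_exponent.
case: ifP => _; first by rewrite lez_nat.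
by rewrite nat_part_le.
Qed.

Lemma same_box_refl (m : 'X_{1..n}) : in_support m -> same_box m m.
Proof.
by move=> adm; apply/same_boxP=> i; split=> // x; apply: in_support_bounds.
Qed.

(** The support is a union of products of boxes, hence of supports of D-Schur
polynomials. *)
Lemma in_support_transfer (m m' : 'X_{1..n}) :
  in_support m -> same_box m m' -> in_support m'.
Proof.
move=> adm /same_boxP H; have dE i : block_degree m' i = block_degree m i.
  by case: (H i).
have cutE := eq_cut_vector_cuts dE.
apply: (in_box_admissible good noncut_ascent (C := mem (cuts D)) _ _ adm).
- exact: (cut_at_mem (i := 0)).
- by have := @cut_at_mem _ D #|D|.+1 (ltnSn _); rewrite cut_at_last.
- by move=> j _; exact: cutE.
move=> c' e' blk ce' x cx xe; have [_ en _ Ce _] := blk.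
have xn : x < n by lia.
have [i xi] := exists_block_index D (Ordinal xn).
have := xi; rewrite block_interval /= => /andP[cx' xe'].
have blk' := block_is_block (leq_ltn_trans cx' xe').
have x_in : c' <= x < e' by rewrite cx.
have x_in' : cut_at D i <= x < cut_at D i.+1 by rewrite cx'.
have [cE eE] := block_unique blk blk' x_in x_in'.
subst c' e'; case: (H i) => /(_ (Ordinal xn) xi) + _.
rewrite -[x]/(nat_of_ord (Ordinal xn)) cut_vector_exponent.
rewrite /block_bound /block_up ce' /=; case: (smaller_before _ _); first by rewrite lez_nat.
by rewrite nat_part_le /lower_bound cutE.
Qed.

Lemma box_size (m : 'X_{1..n}) (i : 'I_#|D|.+1) :
  in_support m ->
  box_size_ok (block_up i) (cut_at D i.+1 - cut_at D i) (block_bound m i)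
    (block_degree m i).
Proof.
move=> adm; have bnd x := @in_support_bounds m i x adm.
have cardE := card_block i; set p := _ - _ in cardE *.
have sumk k : \sum_(x in block i) k = p * k by rewrite sum_nat_const cardE.
rewrite /box_size_ok; case: ifP bnd => [up|_] bnd.
  apply/andP; split; last by rewrite -sumk; apply: leq_sum.
  have /andP[ce sb] := up.
  have blk := block_is_block (ltnW ce).
  have C0 : mem (cuts D) 0 := cut_at_mem (i := 0) (ltn0Sn _).
  have Cn : mem (cuts D) n.
    by have := @cut_at_mem _ D #|D|.+1 (ltnSn _); rewrite cut_at_last.
  have := upper_block_sum_ge good C0 Cn noncut_ascent blk ce sb adm.
  rewrite -sum_block /block_bound up.
  rewrite (eq_bigr (fun x => (m x)%:Z%R)) => [|x _]; last by rewrite cut_vector_exponent.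
  by rewrite sum_Posz lez_nat.
rewrite -sumk leq_sum //=; apply/implyP=> /eqP p0.
have : #|block i| == 0 by rewrite cardE p0.
by rewrite cards_eq0 => /eqP b0; rewrite /block_degree b0 big_set0.
Qed.

Lemma box_weight_partition (m : 'X_{1..n}) :
  in_support m -> is_D_partition (box_weight m).
Proof.
move=> adm i; rewrite tnth_mktuple card_block; split.
  by rewrite /box_shape size_mkseq.
exact: box_shape_sorted (box_size i adm).
Qed.

Lemma mcoeff_D_schur (m m' : 'X_{1..n}) :
  in_support m ->
  ((D_schur (box_weight m))@_m' = (same_box m m')%:R)%R.
Proof.
move=> adm; rewrite /D_schur.
rewrite (@mcoeff_prod_disjoint _ _ _ (fun i => block i)
  (fun i => box_support (block_up i) (cut_at D i) (cut_at D i.+1)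
    (block_bound m i) (block_degree m i))).
- congr ((_ : bool)%:R)%R; rewrite andb_idr => [|_].
    by apply/allP/forallP=> H i; [apply: H; rewrite mem_index_enum|move=> _; exact: H].
  apply/forallP=> x; apply/implyP=> /hasP[]; have [i xi] := exists_block_index D x.
  by exists i => //; rewrite mem_index_enum.
- exact: index_enum_uniq.
- by move=> i j x _ _; apply: block_index_unique.
- move=> i k /andP[/forallP/(_ _) H _] x; rewrite block_interval => /negbTE out.
  by have := H x; rewrite out => /eqP.
- move=> i k; rewrite tnth_mktuple; apply: mcoeff_schur_box.
  + exact: cut_at_mono (leqnSn i) (ltn_ord i : i.+1 < #|D|.+2).
  + exact: cut_at_le (ltn_ord i : i.+1 < #|D|.+2).
  + exact: box_size adm.
  + exact: block_interval.
Qed.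

(** The classes of [same_box] partition the support into the supports of D-Schur
polynomials, one for each weight. Split symmetry holds because permuting the
exponents inside a block preserves every box. *)
Lemma key_D_multiplicity_free : D_multiplicity_free D (key alpha).
Proof.
set f := key alpha.
have fE m : (f@_m = (in_support m)%:R)%R by exact: mcoeff_is_key (key_spec alpha) good m.
split.
  move=> i s s_on; apply/mpolyP=> m; rewrite mcoeff_sym !fE; congr ((_ : bool)%:R)%R.
  have perm_sup (t : {perm 'I_n}) (m1 : 'X_{1..n}) : perm_on (block i) t ->
      in_support m1 -> in_support [multinom m1 (t x) | x < n].
    move=> t_on adm; apply: (in_support_transfer adm); apply/same_boxP=> j.
    have t_block x : (t x \in block j) = (x \in block j).
      have [xi|xi] := boolP (x \in block i); last by rewrite (out_perm t_on).
      have txi : t x \in block i by rewrite perm_closed.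
      by apply/idP/idP=> H; [rewrite -(block_index_unique txi H)|
        rewrite -(block_index_unique xi H)].
    split=> [x xj|]; first by rewrite mnmE in_support_bounds // t_block.
    rewrite /block_degree [RHS](reindex_inj (@perm_inj _ t)).
    by apply: eq_big => x; rewrite ?t_block // mnmE.
  apply/idP/idP=> [|]; last exact: perm_sup.
  have := perm_sup s^-1%g [multinom m (s x) | x < n] (perm_onV s_on).
  congr (_ -> in_support _); apply/mnmP=> x; rewrite !mnmE permKV //.
pose S := seq_fset tt [seq box_weight m | m <- msupp f].
have SP la : la \in S -> exists2 m, in_support m & la = box_weight m.
  rewrite seq_fsetE => /mapP[m]; rewrite mcoeff_msupp fE => mf ->.
  by exists m => //; move: mf; case: in_support.
exists [fsfun la in S => 1%R | 0%R].
  have suppE : finsupp [fsfun la in S => 1%R | 0%R : int] = S.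
    by apply/fsetP=> la; rewrite mem_finsupp fsfunE; case: ifP.
  split=> [la|]; first by rewrite suppE => /SP[m adm ->]; apply: box_weight_partition adm.
  rewrite suppE; apply/mpolyP=> m; rewrite fE raddf_sum /=.
  rewrite big_seq (eq_bigr (fun la => (D_schur la)@_m)%R) => [|la laS]; last first.
    by rewrite fsfunE laS scale1r.
  rewrite -big_seq; have [adm|nadm] := boolP (in_support m); last first.
    rewrite big_seq big1 // => la /SP[m0 adm0 ->].
    rewrite (mcoeff_D_schur _ adm0); case: (boolP (same_box m0 m)) => // sb.
    by rewrite (in_support_transfer adm0 sb) in nadm.
  have mS : box_weight m \in S.
    by rewrite seq_fsetE map_f // mcoeff_msupp fE adm.
  rewrite (big_fsetD1 _ mS) /= (mcoeff_D_schur _ adm) same_box_refl //.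
  rewrite big_seq big1 ?addr0 // => la; rewrite !inE => /andP[ne /SP[m0 adm0 laE]].
  rewrite laE (mcoeff_D_schur _ adm0); case: (boolP (same_box m0 m)) => // sb.
  by rewrite laE (same_box_weight sb) eqxx in ne.
by move=> la; rewrite fsfunE; case: ifP => _; [right|left].
Qed.

End Expansion.

Theorem theorem4p16 (n : nat) (D : {set 'I_n})
    (D_pos : forall d : 'I_n, d \in D -> 0 < d)
    (alpha : n.-tuple nat) (alphaD : in_Comp D alpha)
    (av012 : avoids alpha [:: 0; 1; 2])
    (av0022 : avoids alpha [:: 0; 0; 2; 2])
    (av0021 : avoids alpha [:: 0; 0; 2; 1])
    (av1032 : avoids alpha [:: 1; 0; 3; 2])
    (av1022 : avoids alpha [:: 1; 0; 2; 2])
    (I_or_II : (forall i j : 'I_n, i != j -> tnth alpha i != tnth alpha j) \/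
               avoids alpha [:: 0; 0; 1; 1]) :
  D_multiplicity_free D (key alpha).
Proof.
apply: key_D_multiplicity_free alphaD.
exact: avoidance_almost_dominant.
Qed.
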